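(* Let $L,T,\rho,g,V,v,\epsilon>0$ and $\Lambda>1$ be real numbers and let $\mu$ be a nonnegative finite Borel measure on $[1,\Lambda]$. Then the problem of minimizing $f\mapsto N^{\Lambda,\epsilon}(v,f)$ over $f\in C_V$ has a unique solution $f^{\epsilon,v}\in C_V$. Moreover, $f^{\epsilon,v}$ is even with respect to $x$, i.e. $f^{\epsilon,v}(-x,z)=f^{\epsilon,v}(x,z)$ for a.e. $(x,z)\in\Omega$.
   Context: Let $\Omega=(-L/2,L/2)\times(0,T)$, with points written $(x,z)$. All functions in $H$ are real-valued. Let $$H=\{f\in H^1(\Omega): f(\pm L/2,\cdot)=0 \text{ and } f(\cdot,T)=0 \text{ in the sense of traces}\},$$ a closed subspace of the Sobolev space $H^1(\Omega)$ (no condition is imposed on the side $z=0$). For $f\in H$, $v>0$ and $\lambda\in\mathbb{R}$ with $\lambda\ge 1$, set $$T_f(v,\lambda)=\int_{-L/2}^{L/2}\int_0^T\partial_xf(x,z)\,e^{-\lambda^2vz}e^{-i\lambda vx}\,dz\,dx .$$ Define $$R^\Lambda(v,f)=\frac{4\rho g v}{\pi}\int_{[1,\Lambda]}|T_f(v,\lambda)|^2\,d\mu(\lambda),\qquad N^{\Lambda,\epsilon}(v,f)=R^\Lambda(v,f)+\epsilon\int_\Omega|\nabla f(x,z)|^2\,dx\,dz,$$ and $$C_V=\Big\{f\in H:\ \int_\Omega f\,dx\,dz=V \text{ and } f\ge 0 \text{ a.e. in }\Omega\Big\}.$$ *)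

(* Defs.v *)
From HB Require Import structures.
From mathcomp Require Import all_boot all_order all_algebra.
From mathcomp Require Import complex.
From mathcomp Require Import all_classical all_reals all_analysis.

Set Implicit Arguments.
Unset Strict Implicit.
Unset Printing Implicit Defensive.

Import Order.TTheory GRing.Theory Num.Theory.
Import numFieldNormedType.Exports.

Local Open Scope classical_set_scope.
Local Open Scope ring_scope.

Section defs.
Context {R : realType}.
Implicit Types (f g phi : R * R -> R) (p e : R * R).

Definition leb1 : {measure set (measurableTypeR R) -> \bar R} :=
  @lebesgue_measure R.
Definition leb2 : {measure set (measurableTypeR R * measurableTypeR R) -> \bar R} :=
  (@lebesgue_measure R \x @lebesgue_measure R)%E.

Definition ex : R * R := (1, 0).
Definition ez : R * R := (0, 1).

Fixpoint Ck (k : nat) f : Prop :=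
  continuous f /\
  if k is k'.+1 then
    [/\ forall p, derivable f p ex, forall p, derivable f p ez,
        Ck k' (fun p => 'D_ex f p) & Ck k' (fun p => 'D_ez f p)]
  else True.

Definition smooth f : Prop := forall k, Ck k f.

Definition test_fun (D : set (R * R)) phi : Prop :=
  [/\ smooth phi, compact (closure [set p | phi p != 0])
    & closure [set p | phi p != 0] `<=` D].

Definition L2 (D : set (R * R)) f : Prop :=
  measurable_fun (D : set (measurableTypeR R * measurableTypeR R)) f /\
  leb2.-integrable D (fun p => (f p ^+ 2)%:E).

Definition weak_derive (D : set (R * R)) e f g : Prop :=
  L2 D g /\
  forall phi, test_fun D phi ->
    \int[leb2]_(p in D) (f p * 'D_e phi p) = - \int[leb2]_(p in D) (g p * phi p).

Definition H1 (D : set (R * R)) f : Prop :=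
  [/\ L2 D f, exists g, weak_derive D ex f g & exists g, weak_derive D ez f g].

(* A representative of the weak derivative, which is unique up to equality
   almost everywhere on [D]; the zero function if there is none. *)
Definition wD (D : set (R * R)) e f : R * R -> R :=
  xget (fun=> 0) [set g | weak_derive D e f g].

Definition cvg_H1 (D : set (R * R)) (phi : nat -> R * R -> R) f : Prop :=
  [/\ (\int[leb2]_(p in D) ((phi n p - f p) ^+ 2)%:E)%E @[n --> \oo] --> 0%E,
      (\int[leb2]_(p in D) (('D_ex (phi n) p - wD D ex f p) ^+ 2)%:E)%E
        @[n --> \oo] --> 0%E
    & (\int[leb2]_(p in D) (('D_ez (phi n) p - wD D ez f p) ^+ 2)%:E)%E
        @[n --> \oo] --> 0%E].

(* [h] is the trace of [f] on the side [gamma @` I] of the boundary of [D],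
   parametrised by arc length: the trace operator is the extension by
   continuity, from H^1(D) to L^2 of the side, of the restriction map defined on
   functions that are smooth up to the boundary. *)
Definition is_trace (D : set (R * R)) (I : set R) (gamma : R -> R * R)
    f (h : R -> R) : Prop :=
  exists phi : nat -> R * R -> R,
    [/\ forall n, smooth (phi n), cvg_H1 D phi f
      & (\int[leb1]_(s in I) ((phi n (gamma s) - h s) ^+ 2)%:E)%E
          @[n --> \oo] --> 0%E].

Section problem.
Variables (L T : R).

Definition Omega : set (R * R) := `]- (L / 2), L / 2[%classic `*` `]0, T[%classic.

Definition H f : Prop :=
  [/\ H1 Omega f,
      is_trace Omega `]0, T[ (fun z => (- (L / 2), z)) f (fun=> 0),
      is_trace Omega `]0, T[ (fun z => (L / 2, z)) f (fun=> 0)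
    & is_trace Omega `]- (L / 2), L / 2[ (fun x => (x, T)) f (fun=> 0)].

Definition expi (t : R) : R[i] := (cos t +i* sin t)%C.

Definition Cintegral (D : set R) (F : R -> R[i]) : R[i] :=
  ((\int[leb1]_(t in D) complex.Re (F t)) +i*
   (\int[leb1]_(t in D) complex.Im (F t)))%C.

Definition Tf f (v lambda : R) : R[i] :=
  Cintegral `]- (L / 2), L / 2[ (fun x =>
    Cintegral `]0, T[ (fun z =>
      ((wD Omega ex f (x, z) * expR (- (lambda ^+ 2 * v * z)))%:C)%C
      * expi (- (lambda * v * x)))).

(* [mu] lives on the whole line, but only its restriction to [1, Lambda]
   matters: a measure on [1, Lambda] is the same as its extension by zero. *)
Definition wave_resistance (rho g Lambda : R)
    (mu : {finite_measure set (measurableTypeR R) -> \bar R}) (v : R) f : R :=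
  4 * rho * g * v / pi *
  \int[mu]_(lambda in `[1, Lambda]) (Normc.normc (Tf f v lambda) ^+ 2).

Definition dirichlet f : R :=
  \int[leb2]_(p in Omega) (wD Omega ex f p ^+ 2 + wD Omega ez f p ^+ 2).

Definition N (rho g Lambda eps : R)
    (mu : {finite_measure set (measurableTypeR R) -> \bar R}) (v : R) f : R :=
  wave_resistance rho g Lambda mu v f + eps * dirichlet f.

Definition CV (V : R) f : Prop :=
  [/\ H f, \int[leb2]_(p in Omega) f p = V
    & {ae leb2, forall p, Omega p -> 0 <= f p}].

End problem.

Definition minimizer (C : (R * R -> R) -> Prop) (J : (R * R -> R) -> R) f : Prop :=
  C f /\ forall g, C g -> J f <= J g.

End defs.

(* Main.v *)
Require Import Defs.
From mathcomp Require Import all_boot all_order all_algebra.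
From mathcomp Require Import complex.
From mathcomp Require Import all_classical all_reals all_analysis.
From mathcomp Require Import measurable_realfun.
From mathcomp Require Import ring lra.
Set Implicit Arguments.
Unset Strict Implicit.
Unset Printing Implicit Defensive.
Import Order.TTheory GRing.Theory Num.Theory.
Import numFieldNormedType.Exports.
Local Open Scope classical_set_scope.
Local Open Scope ring_scope.

(* The functional is a continuous quadratic form in the gradient of [f] and
   dominates [eps] times the Dirichlet integral. Since [C_V] is convex, the
   parallelogram identity turns this into uniform convexity: two almost
   minimizers have gradients that are close in [L^2]. Hence a minimizing
   sequence has Cauchy gradients, and it is itself Cauchy by the Poincare
   inequality, which holds because the trace vanishes on the side [x = -L/2].
   The limit stays in [C_V]: weak derivatives, zero traces, mean and sign all
   survive [L^2] limits of the functions and their gradients. The same estimate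
   applied to two minimizers shows uniqueness, and the reflection [x -> -x]
   preserves both [C_V] and the functional, so that the minimizer is even.
   Weak derivatives are unique because tensor products of one-variable bumps
   converge to the indicators of rectangles, which generate the Borel sets. *)

(** * Square-integrable functions *)

(** Convergence is strong throughout: the minimizing sequence converges in [L^2] together with its
    gradients, and the energy passes to the limit by continuity. That continuity comes from the wave
    kernel, whose modulus is at most 1 on the box because [v] and [z] are positive there.
    Cauchy-Schwarz then bounds [|T_f|^2] by [L T] times the squared norm of the [x]-derivative,
    uniformly in [lambda], and [mu] is finite. The wave resistance alone is only nonnegative;
    coercivity comes from the term with [eps]. The obstacle is that [N] reads gradients through
    [wD], a representative picked by choice, which commutes with sums, limits and reflections only
    almost everywhere. Uniqueness of weak derivatives therefore has to precede any algebra on [N].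
    Weak derivatives and the mean are closed conditions because they are identities between inner
    products; vanishing traces are closed because they amount to the existence, for every [d > 0],
    of a smooth function within [d]. *)

Section limn_einf.
Context {R : realType}.
Implicit Types (u : (\bar R)^nat) (l : \bar R).

Lemma limn_einf_le u l : (forall n, u n <= l)%E -> (limn_einf u <= l)%E.
Proof.
move=> ul; rewrite limn_einf_lim; apply: lime_le; first exact: is_cvg_einfs.
apply: nearW => k; apply: le_trans (ul k).
by apply: ereal_inf_lbound; exists k => /=.
Qed.

Lemma limn_einf_ge u l : (forall n, l <= u n)%E -> (l <= limn_einf u)%E.
Proof.
move=> ul; rewrite limn_einf_lim; apply: lime_ge; first exact: is_cvg_einfs.
by apply: nearW => k; apply: le_ereal_inf_tmp => _ [n _ <-].
Qed.

Lemma measurable_fun_limn_einf d (T : measurableType d) (D : set T)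
    (f : nat -> T -> \bar R) : (forall n, measurable_fun D (f n)) ->
  measurable_fun D (fun x => limn_einf (f ^~ x)).
Proof.
move=> mf; rewrite (_ : (fun x => _) = (fun x => - limn_esup (fun n => - f n x))%E).
  apply: measurableT_comp => //; apply: measurable_fun_limn_esup => n.
  exact: measurableT_comp.
apply/funext => x; rewrite -limn_einfN; congr limn_einf.
by apply/funext => n /=; rewrite oppeK.
Qed.

End limn_einf.

Section square_integrable.
Context d (T : measurableType d) (R : realType)
  (mu : {measure set T -> \bar R}) (D : set T).
Hypothesis mD : measurable D.
Implicit Types f g : T -> R.

(** Convertible to [L2] when the measure is [leb2]; the general form also serves on the sides of the
    box and for [mu] on [[1, Lambda]]. The companion [ssq] is the square of the norm, which keeps
    the estimates almost free of square roots. *)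
Definition sqint f :=
  measurable_fun D f /\ mu.-integrable D (fun x => (f x ^+ 2)%:E).

Definition ssq f : R := \int[mu]_(x in D) (f x ^+ 2).

Definition ip f g : R := \int[mu]_(x in D) (f x * g x).

Lemma le_integrableR f g : measurable_fun D f ->
  (forall x, D x -> `|f x| <= g x) -> mu.-integrable D (EFin \o g) ->
  mu.-integrable D (EFin \o f).
Proof.
move=> mf fg ig; apply: le_integrable ig => //; first exact/measurable_EFinP.
by move=> x Dx /=; rewrite lee_fin (le_trans (fg x Dx))// ler_norm.
Qed.

Lemma sqint_mul f g : sqint f -> sqint g ->
  mu.-integrable D (EFin \o (fun x => f x * g x)).
Proof.
move=> [mf If] [mg Ig].
apply: (@le_integrableR _ (fun x => f x ^+ 2 + g x ^+ 2)).
- exact: measurable_funM.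
- move=> x _; rewrite normrM -(real_normK (num_real (f x))).
  rewrite -(real_normK (num_real (g x))).
  have := sqr_ge0 (`|f x| - `|g x|); have := normr_ge0 (f x).
  by have := normr_ge0 (g x); nra.
- rewrite (_ : EFin \o _ = (fun x => (f x ^+ 2)%:E) \+ (fun x => (g x ^+ 2)%:E))%E.
    exact: integrableD.
  by apply/funext.
Qed.

Lemma sqint_sqr f : sqint f -> mu.-integrable D (EFin \o (fun x => f x ^+ 2)).
Proof. by case. Qed.

Lemma integrable_lin a b f g : mu.-integrable D (EFin \o f) ->
  mu.-integrable D (EFin \o g) ->
  mu.-integrable D (EFin \o (fun x => a * f x + b * g x)).
Proof.
move=> If Ig.
have -> : EFin \o (fun x => a * f x + b * g x) =
  (fun x => a%:E * (EFin \o f) x)%E \+ (fun x => b%:E * (EFin \o g) x)%E.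
  by apply/funext => x.
by apply: integrableD => //; apply: integrableZl.
Qed.

Lemma Rintegral_lin a b f g : mu.-integrable D (EFin \o f) ->
  mu.-integrable D (EFin \o g) ->
  \int[mu]_(x in D) (a * f x + b * g x) =
  a * \int[mu]_(x in D) f x + b * \int[mu]_(x in D) g x.
Proof.
move=> If Ig; rewrite RintegralD//.
- by rewrite !RintegralZl.
- by have := integrable_lin a 0 If Ig; congr integrable; apply/funext => x /=;
    rewrite mul0r addr0.
- by have := integrable_lin 0 b If Ig; congr integrable; apply/funext => x /=;
    rewrite mul0r add0r.
Qed.

Lemma sqint_lin a b f g : sqint f -> sqint g ->
  sqint (fun x => a * f x + b * g x).
Proof.
move=> sf sg; have [mf If] := sf; have [mg Ig] := sg; split.
  by apply: measurable_funD; apply: measurable_funM => //.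
rewrite (_ : (fun x => _) = EFin \o (fun x => 1 * (a ^+ 2 * f x ^+ 2 + b ^+ 2 * g x ^+ 2)
  + 2 * a * b * (f x * g x))); last by apply/funext => x /=; congr EFin; ring.
apply: integrable_lin; first exact: integrable_lin.
exact: sqint_mul.
Qed.

Lemma sqintB f g : sqint f -> sqint g -> sqint (fun x => f x - g x).
Proof.
move=> sf sg; have := sqint_lin 1 (-1) sf sg; congr sqint.
by apply/funext => x; ring.
Qed.

Lemma sqintZ a f : sqint f -> sqint (fun x => a * f x).
Proof.
move=> sf; have := sqint_lin a 0 sf sf; congr sqint.
by apply/funext => x; ring.
Qed.

Lemma ssq_ge0 f : 0 <= ssq f.
Proof. by apply: Rintegral_ge0 => x _; apply: sqr_ge0. Qed.

Lemma ssqE f : sqint f -> (\int[mu]_(x in D) (f x ^+ 2)%:E)%E = (ssq f)%:E.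
Proof. by move=> [mf If]; rewrite fineK//; apply: integrable_fin_num. Qed.

Lemma ssq_lin a b f g : sqint f -> sqint g ->
  ssq (fun x => a * f x + b * g x) =
  a ^+ 2 * ssq f + 2 * a * b * ip f g + b ^+ 2 * ssq g.
Proof.
move=> sf sg; rewrite /ssq.
under eq_Rintegral => x _.
  rewrite (_ : _ ^+ 2 = 1 * (a ^+ 2 * f x ^+ 2 + b ^+ 2 * g x ^+ 2)
  + 2 * a * b * (f x * g x)); last by ring.
  over.
have [mf If] := sf; have [mg Ig] := sg.
rewrite Rintegral_lin ?Rintegral_lin// /ip; first by ring.
- exact: integrable_lin.
- exact: sqint_mul.
Qed.

Lemma ip_linl a b f g h : sqint f -> sqint g -> sqint h ->
  ip (fun x => a * f x + b * g x) h = a * ip f h + b * ip g h.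
Proof.
move=> sf sg sh; rewrite /ip -Rintegral_lin; [|exact: sqint_mul..].
by apply: eq_Rintegral => x _; ring.
Qed.

Lemma ssqZ a f : sqint f -> ssq (fun x => a * f x) = a ^+ 2 * ssq f.
Proof.
move=> sf; have := ssq_lin a 0 sf sf; rewrite !(mulr0, mul0r, expr0n)/= !addr0 => <-.
by apply: eq_Rintegral => x _; congr (_ ^+ 2); ring.
Qed.

Lemma cauchy_schwarz f g : sqint f -> sqint g -> ip f g ^+ 2 <= ssq f * ssq g.
Proof.
move=> sf sg.
have Q a b : 0 <= a ^+ 2 * ssq f + 2 * a * b * ip f g + b ^+ 2 * ssq g.
  by rewrite -ssq_lin// ssq_ge0.
have F := ssq_ge0 f; have G := ssq_ge0 g.
have [G0|G0] := eqVneq (ssq g) 0.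
  (* When [ssq g = 0] the form is affine in its second coefficient; these weights give
     [- (2 + ssq f) * ip f g ^+ 2 >= 0], hence [ip f g = 0]. *)
  have := Q (ip f g) (- (1 + ssq f)); rewrite G0 !mulr0 !addr0.
  by have := sqr_ge0 (ip f g); nra.
have {}G0 : 0 < ssq g by rewrite lt_neqAle eq_sym G0.
have := Q (ssq g) (- ip f g) => H.
suff : 0 <= ssq g * (ssq f * ssq g - ip f g ^+ 2) by rewrite pmulr_rge0// subr_ge0.
by apply: le_trans H _; rewrite le_eqVlt; apply/orP; left; apply/eqP; ring.
Qed.

(** The difference of the two sides is [ssq (f - g)]. This replaces the triangle inequality for
    squared norms. *)
Lemma ssqD_le f g : sqint f -> sqint g ->
  ssq (fun x => f x + g x) <= 2 * ssq f + 2 * ssq g.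
Proof.
move=> sf sg; have := ssq_lin 1 1 sf sg; have := ssq_lin 1 (-1) sf sg.
have := ssq_ge0 (fun x => 1 * f x + -1 * g x); move=> + E.
rewrite {}E; have -> : ssq (fun x => f x + g x) = ssq (fun x => 1 * f x + 1 * g x).
  by apply: eq_Rintegral => x _; rewrite !mul1r.
by move=> + ->; nra.
Qed.

Lemma ssqB_le f g h : sqint f -> sqint g -> sqint h ->
  ssq (fun x => f x - h x) <=
  2 * ssq (fun x => f x - g x) + 2 * ssq (fun x => g x - h x).
Proof.
move=> sf sg sh; rewrite -[X in _ <= X]/(_ + _).
have := ssqD_le (sqintB sf sg) (sqintB sg sh); congr (_ <= _).
by apply: eq_Rintegral => x _; congr (_ ^+ 2); ring.
Qed.

Lemma eq_ssq f g : (forall x, D x -> f x = g x) -> ssq f = ssq g.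
Proof. by move=> fg; apply: eq_Rintegral => x /set_mem Dx; rewrite fg. Qed.

Lemma ssqBC f g : ssq (fun x => f x - g x) = ssq (fun x => g x - f x).
Proof. by apply: eq_Rintegral => x _; ring. Qed.

Lemma ae_eq_Rintegral f g : measurable_fun D f -> measurable_fun D g ->
  {ae mu, forall x, D x -> f x = g x} ->
  \int[mu]_(x in D) f x = \int[mu]_(x in D) g x.
Proof.
move=> mf mg fg; congr fine; apply: ae_eq_integral => //.
- exact/measurable_EFinP.
- exact/measurable_EFinP.
- by apply: filterS fg => x fg Dx; rewrite fg.
Qed.

Lemma ae_eq_ssq f g : measurable_fun D f -> measurable_fun D g ->
  {ae mu, forall x, D x -> f x = g x} -> ssq f = ssq g.
Proof.
move=> mf mg fg; apply: ae_eq_Rintegral.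
- exact: measurable_funX.
- exact: measurable_funX.
- by apply: filterS fg => x fg Dx; rewrite fg.
Qed.

Lemma ssq_eq0 f : sqint f -> ssq f = 0 -> {ae mu, forall x, D x -> f x = 0}.
Proof.
move=> sf f0; have [mf If] := sf.
have : (\int[mu]_(x in D) `|(f x ^+ 2)%:E|)%E = 0%E.
  under eq_integral => x _ do rewrite gee0_abs ?lee_fin ?sqr_ge0//.
  by rewrite ssqE// f0.
move/ae_eq_integral_abs => /(_ mD (measurable_int _ If)).
apply: filterS => x /[apply] /= -[] /eqP.
by rewrite sqrf_eq0 => /eqP.
Qed.

Lemma integrable_cstR (M : R) : (mu D < +oo)%E ->
  mu.-integrable D (EFin \o (fun=> M)).
Proof.
move=> muD; apply/integrableP; split; first exact: (measurable_cst M%:E).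
by rewrite (_ : (fun x => _) = cst `|M|%:E)// integral_cst//= lte_mul_pinfty.
Qed.

Lemma sqint_bounded f (M : R) : (mu D < +oo)%E -> measurable_fun D f ->
  (forall x, D x -> `|f x| <= M) -> sqint f.
Proof.
move=> muD mf fM; split => //.
apply: (@le_integrableR _ (cst (M ^+ 2))).
- exact: measurable_funX.
- move=> x Dx; rewrite normrX lerXn2r ?nnegrE ?fM//.
  exact: le_trans (fM x Dx).
- exact: integrable_cstR.
Qed.

Lemma ssq_bounded f (M : R) : (mu D < +oo)%E -> measurable_fun D f ->
  (forall x, D x -> `|f x| <= M) -> ssq f <= M ^+ 2 * fine (mu D).
Proof.
move=> muD mf fM; rewrite -Rintegral_cst//; apply: le_Rintegral => //.
- by have [] := sqint_bounded muD mf fM.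
- exact: integrable_cstR.
- move=> x Dx; rewrite -(real_normK (num_real (f x))).
  by rewrite lerXn2r ?nnegrE ?fM// (le_trans _ (fM x Dx)).
Qed.

Lemma ssq_le f g (M : R) : 0 <= M -> sqint f -> sqint g ->
  (forall x, D x -> `|f x| <= M * `|g x|) -> ssq f <= M ^+ 2 * ssq g.
Proof.
move=> M0 sf sg fg; have [_ If] := sf; have [_ Ig] := sg.
rewrite /ssq -RintegralZl//; apply: le_Rintegral => //.
  have := integrable_lin (M ^+ 2) 0 Ig Ig.
  by congr integrable; apply/funext => p; rewrite /= mul0r addr0.
move=> x Dx; rewrite -exprMn -(real_normK (num_real (f x))).
rewrite -[leRHS](real_normK (num_real _)) lerXn2r ?nnegrE//.
by rewrite normrM (ger0_norm M0) fg.
Qed.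

(** Pointwise [|f| <= (t f^2 + 1/t) / 2]. The free weight [t] balances a small [ssq f] against the
    measure of [D]. *)
Lemma le_integral_norm f t : (mu D < +oo)%E -> 0 < t -> sqint f ->
  (\int[mu]_(x in D) `|(f x)%:E| <=
    ((t * ssq f + t^-1 * fine (mu D)) / 2)%:E)%E.
Proof.
move=> muD t0 sf; have [mf If] := sf.
have IF : mu.-integrable D (EFin \o (fun x => t / 2 * f x ^+ 2 + t^-1 / 2 * 1)).
  by apply: integrable_lin => //; exact: integrable_cstR.
apply: (@le_trans _ _ (\int[mu]_(x in D) (t / 2 * f x ^+ 2 + t^-1 / 2 * 1)%:E)%E).
  apply: ge0_le_integral => //.
  - by apply/measurable_EFinP; exact: measurableT_comp.
  - exact: (measurable_int _ IF).
  - move=> x _; rewrite /= lee_fin mulr1 -(real_normK (num_real (f x))).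
    have ti : t * t^-1 = 1 by rewrite divff// gt_eqF.
    have ti0 : 0 < t^-1 by rewrite invr_gt0.
    have := sqr_ge0 (t * `|f x| - 1) => H.
    have : 0 <= t^-1 * (t * `|f x| - 1) ^+ 2 by rewrite mulr_ge0// ltW.
    rewrite (_ : t^-1 * _ = (t * t^-1) * (t * `|f x| ^+ 2) - 2 * (t * t^-1) * `|f x| + t^-1); last by ring.
    by rewrite ti; lra.
rewrite -[leLHS]fineK; last exact: integrable_fin_num.
rewrite lee_fin -/(Rintegral mu D _) Rintegral_lin//; last exact: integrable_cstR.
by rewrite Rintegral_cst// mul1r -/(ssq f) le_eqVlt; apply/orP; left; apply/eqP; ring.
Qed.

(** The sum of the absolute increments is integrable by monotone convergence, hence finite almost
    everywhere; there the telescoping series converges absolutely. *)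
Lemma ae_cvg_of_summable_norm (h : nat -> T -> R) :
  (forall k, measurable_fun D (h k)) ->
  (\sum_(k <oo) \int[mu]_(x in D) `|(h k.+1 x - h k x)%:E| < +oo)%E ->
  {ae mu, forall x, D x -> cvgn (h ^~ x)}.
Proof.
move=> mh hoo.
have md k : measurable_fun D (fun x => `|(h k.+1 x - h k x)%:E|%E).
  by apply: measurableT_comp => //; apply/measurable_EFinP; exact: measurable_funB.
have Ih : mu.-integrable D (fun x => \sum_(k <oo) `|(h k.+1 x - h k x)%:E|)%E.
  apply/integrableP; split.
    by apply: ge0_emeasurable_sum.
  under eq_integral => x _.
    rewrite gee0_abs; last by apply: nneseries_ge0.
    over.
  by rewrite integral_nneseries.
have := integrable_ae mD Ih.
apply: filterS => x /[apply] hx.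
have cs : cvgn (series (fun k => h k.+1 x - h k x)).
  apply: normed_cvg; apply: nondecreasing_is_cvgn.
    apply/nondecreasing_seqP => n.
    by rewrite -[leLHS]addr0 -[leRHS]/(series _ n.+1) seriesSr lerD2l normr_ge0.
  exists (fine (\sum_(k <oo) `|(h k.+1 x - h k x)%:E|)%E) => _ [n _ <-].
  rewrite -lee_fin fineK// /series/=.
  apply: le_trans (nneseries_lim_ge n _); last by [].
  by rewrite -sumEFin.
suff -> : h ^~ x = (fun n => series (fun k => h k.+1 x - h k x) n + h 0%N x).
  by apply: is_cvgD => //; exact: is_cvg_cst.
by apply/funext => n; rewrite /series/= telescope_sumr// subrK.
Qed.

(** Riesz-Fischer. A subsequence with geometrically small increments converges almost everywhere,
    and Fatou's lemma transfers the Cauchy bound to the limit. The rate [4^-k] is for squared norms,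
    so the norms decay like [2^-k]. *)
Lemma ssq_complete (f : nat -> T -> R) : (mu D < +oo)%E ->
  (forall n, sqint (f n)) ->
  (forall e : R, 0 < e -> exists N, forall n m, (N <= n)%N -> (N <= m)%N ->
    ssq (fun x => f n x - f m x) <= e) ->
  exists g, sqint g /\ (forall e : R, 0 < e -> exists N, forall n, (N <= n)%N ->
    ssq (fun x => f n x - g x) <= e).
Proof.
move=> muD sf cf.
have /choice[N HN] : forall k, exists N, forall n m, (N <= n)%N -> (N <= m)%N ->
    ssq (fun x => f n x - f m x) <= (4^-1) ^+ k.
  by move=> k; apply: cf; apply: exprn_gt0; rewrite invr_gt0.
(* The sum dominates every [N j] with [j <= k], so [u k] and [u k.+1] are both beyond [N k]; the
   summand [k] makes [u] go to infinity. *)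
pose u k := (k + \sum_(j < k.+1) N j)%N.
have uN j k : (j <= k)%N -> (N j <= u k)%N.
  move=> jk; rewrite (leq_trans _ (leq_addl _ _))//.
  by rewrite (bigD1 (Ordinal (jk : (j < k.+1)%N)))//= leq_addr.
pose h k := f (u k).
have mh k : measurable_fun D (h k) by have [] := sf (u k).
have cvgh : {ae mu, forall x, D x -> cvgn (h ^~ x)}.
  apply: ae_cvg_of_summable_norm => //.
  (* With [t = 2^k] and [ssq <= 4^-k], [le_integral_norm] bounds the [k]-th increment by [C 2^-k],
     and the series by [2 C]. *)
  pose C := (1 + fine (mu D)) / 2.
  have C0 : 0 <= C by rewrite divr_ge0// addr_ge0// fine_ge0.
  apply: (@le_lt_trans _ _ (C *+ 2)%:E); last exact: ltry.
  apply: lime_le.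
    by apply: is_cvg_nneseries => *; exact: integral_ge0.
  apply: nearW => n.
  apply: (@le_trans _ _ (\sum_(0 <= k < n) (C * (2^-1) ^+ k)%:E)%E).
    apply: lee_sum => k _.
    apply: le_trans (le_integral_norm muD _ (sqintB (sf (u k.+1)) (sf (u k)))) _.
      exact: (exprn_gt0 k (ltr0Sn R 1)).
    rewrite lee_fin -exprVn.
    have : ssq (fun x => f (u k.+1) x - f (u k) x) <= (4^-1) ^+ k.
      by apply: HN; apply: uN.
    have -> : (4^-1 : R) ^+ k = (2^-1) ^+ k * (2^-1) ^+ k.
      by rewrite -exprMn -invfM -natrM.
    move=> H; have p2 : 0 < (2 : R) ^+ k by rewrite exprn_gt0.
    have q2 : 2 ^+ k * (2^-1) ^+ k = 1 :> R by rewrite -exprMn divff// expr1n.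
    have r2 : 0 < (2^-1 : R) ^+ k by rewrite exprn_gt0.
    set S := ssq _ in H *; rewrite /C; set M := fine _.
    have : 2 ^+ k * S <= (2^-1) ^+ k.
      by move: H; rewrite -(ler_pM2l p2) mulrA q2 mul1r.
    by nra.
  have geo : \sum_(0 <= k < n) (2^-1 : R) ^+ k = 2 - 2 * (2^-1) ^+ n.
    elim: (n) => [|m IH]; first by rewrite big_nil expr0 mulr1 subrr.
    by rewrite big_nat_recr//= IH exprS; lra.
  rewrite sumEFin lee_fin -mulr_sumr geo mulr2n.
  have : 0 <= (2^-1 : R) ^+ n by rewrite exprn_ge0.
  by nra.
(* The upper limit is measurable on all of [D] and agrees with the limit wherever that exists;
   elsewhere, on a null set, its value is irrelevant. *)
pose g x := fine (limn_esup (fun k => (h k x)%:E)).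
have mg : measurable_fun D g.
  apply: measurableT_comp => //.
  apply: measurable_fun_limn_esup => k; exact/measurable_EFinP.
have hg : {ae mu, forall x, D x -> h ^~ x @ \oo --> g x}.
  apply: filterS cvgh => x /[apply] ch.
  have cE : (fun k => (h k x)%:E) @ \oo --> (limn (h ^~ x))%:E.
    by apply: cvg_EFin => //; exact: nearW.
  rewrite /g is_cvg_limn_esupE; last by apply/cvg_ex; eexists; exact: cE.
  by rewrite (cvg_lim _ cE).
(* Fatou's lemma in the second index, with [n] fixed, along the subsequence shifted by [M]. The
   bound is on the extended integral, as [g] is so far only known to be measurable. *)
have key e n M : (forall m, (M <= m)%N -> ssq (fun x => f n x - f m x) <= e) ->
  (\int[mu]_(x in D) ((f n x - g x) ^+ 2)%:E <= e%:E)%E.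
  move=> HM; have mfn : measurable_fun D (f n) by have [] := sf n.
  have mfh k : measurable_fun D (fun x => ((f n x - h k x) ^+ 2)%:E).
    by apply/measurable_EFinP; apply: measurable_funX; exact: measurable_funB.
  have h0 k x : D x -> (0 <= ((f n x - h (k + M)%N x) ^+ 2)%:E)%E.
    by rewrite lee_fin sqr_ge0.
  have F := @fatou _ T R mu D mD (fun k x => ((f n x - h (k + M)%N x) ^+ 2)%:E)
    (fun k => mfh (k + M)%N) h0.
  apply: le_trans (_ : _ <= limn_einf (fun k =>
    \int[mu]_(x in D) ((f n x - h (k + M)%N x) ^+ 2)%:E))%E _.
    apply: le_trans F; apply: ae_ge0_le_integral => //.
    - by move=> x _; rewrite lee_fin sqr_ge0.
    - by apply/measurable_EFinP; apply: measurable_funX; exact: measurable_funB.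
    - by move=> x Dx; rewrite limn_einf_ge// => k; exact: h0.
    - by apply: measurable_fun_limn_einf => k; exact: mfh.
    apply: filterS hg => x /[apply] hg.
    have cE : (fun k => ((f n x - h (k + M)%N x) ^+ 2)%:E) @ \oo -->
        ((f n x - g x) ^+ 2)%:E.
      apply: cvg_EFin; first exact: nearW.
      under eq_fun do rewrite /= expr2; rewrite expr2.
      have cd : (fun k => f n x - h (k + M)%N x) @ \oo --> f n x - g x.
        apply: cvgB; first exact: cvg_cst.
        by have := hg; rewrite -(cvg_shiftn M (h ^~ x)).
      exact: (cvgM cd cd).
    rewrite is_cvg_limn_einfE; last by apply/cvg_ex; eexists; exact: cE.
    by rewrite (cvg_lim _ cE).
  apply: limn_einf_le => k.
  rewrite (ssqE (sqintB (sf n) (sf (u (k + M)%N)))) lee_fin; apply: HM.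
  by rewrite /u (leq_trans _ (leq_addr _ _))// leq_addl.
(* A finite bound for one index makes [f M - g] square integrable, and thereby [g]. *)
have [M HM] := cf 1 ltr01.
have sfg : sqint (fun x => f M x - g x).
  split; first by apply: measurable_funB => //; have [] := sf M.
  apply/integrableP; split.
    apply/measurable_EFinP; apply: measurable_funX; apply: measurable_funB => //.
    by have [] := sf M.
  under eq_integral => x _ do rewrite gee0_abs ?lee_fin ?sqr_ge0//.
  apply: le_lt_trans (key 1 M M _) (ltry _).
  by move=> m Mm; apply: HM.
have sg : sqint g.
  have := sqintB (sf M) sfg; congr sqint.
  by apply/funext => x; rewrite opprB addrC subrK.
exists g; split => // e e0; have [N' HN'] := cf e e0; exists N' => n N'n.
rewrite -lee_fin -ssqE//; last exact: sqintB.
by apply: (key _ _ N') => m N'm; exact: HN'.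
Qed.

End square_integrable.

(** * Smooth functions of two variables *)

Section directional_derivative.
Context {R : realType}.

Lemma is_deriveP {V W : normedModType R} (f : V -> W) (p e : V) (c : W) :
  is_derive p e f c <-> h^-1 *: (f (h *: e + p) - f p) @[h --> 0^'] --> c.
Proof.
split=> [Hf|Hc].
  have := @ex_derive _ _ _ _ _ _ _ Hf; rewrite /derivable => /cvg_ex[l Hl].
  have := @derive_val _ _ _ _ _ _ _ Hf; rewrite /derive (cvg_lim _ Hl)//.
  by move=> <-.
apply: DeriveDef; first by apply/cvg_ex; exists c.
exact: (cvg_lim _ Hc).
Qed.

Lemma is_derive_line {V W : normedModType R} (f : V -> W) (p e : V) (c : W) (s : R) :
  is_derive (p + s *: e) e f c <->
  is_derive s (1 : R) (fun t : R => f (p + t *: e)) c.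
Proof.
rewrite !is_deriveP.
suff -> : (fun h : R => h^-1 *: (f (h *: e + (p + s *: e)) - f (p + s *: e))) =
  (fun h : R => h^-1 *: (f (p + (h *: 1 + s) *: e) - f (p + s *: e))) by [].
apply/funext => h; congr (_ *: (f _ - _)).
by rewrite addrCA scalerDl -scalerA scale1r.
Qed.

(** [A] sends the line of direction [e] through [p] to one of direction [e'], at speed [c], so the
    one-variable chain rule applies. Used for the coordinate projections ([c = 0] or [1]) and for
    the reflection ([c = -1] or [1]). *)
Lemma is_derive_comp_affine {V V' : normedModType R} (f : V' -> R)
    (A : V -> V') (p e : V) (e' : V') (c d : R) :
  (forall t : R, A (p + t *: e) = A p + (c * t) *: e') ->
  is_derive (A p) e' f d -> is_derive p e (f \o A) (c * d).
Proof.
move=> HA H.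
have H2 : is_derive (c * 0) (1 : R) (fun t : R => f (A p + t *: e')) d.
  rewrite mulr0; apply: (proj1 (is_derive_line f (A p) e' d 0)).
  rewrite scale0r addr0; exact: H.
have H3 : is_derive (0 : R) (1 : R) (fun t : R => c * t) c.
  rewrite -[X in is_derive _ _ _ X](_ : c *: 1 = c); first exact: is_deriveZ.
  by rewrite /GRing.scale/= mulr1.
suff : is_derive (p + 0 *: e) e (f \o A) (c * d) by rewrite scale0r addr0.
apply: (proj2 (is_derive_line _ _ _ _ _)); rewrite mulrC.
rewrite (_ : (fun t => _) = (fun t => f (A p + t *: e')) \o (fun t => c * t)).
  exact: is_derive1_comp H2 H3.
by apply/funext => t /=; rewrite HA.
Qed.

End directional_derivative.

Section smooth_calculus.
Context {R : realType}.
Implicit Types (f g : R * R -> R) (p e : R * R) (k : nat).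

Lemma Ck_continuous k f : Ck k f -> continuous f.
Proof. by case: k => [[]|k []]. Qed.

Lemma CkS k f : Ck k.+1 f -> Ck k f.
Proof.
elim: k f => [|k IH] f [cf H]; first by split.
have [dx dz Dx Dz] := H; split; first exact: cf.
split; [exact: dx|exact: dz|exact: (IH _ Dx)|exact: (IH _ Dz)].
Qed.

Lemma CkSP k f : Ck k.+1 f <-> continuous f /\ exists fx fz,
  [/\ forall p, is_derive p ex f (fx p), forall p, is_derive p ez f (fz p),
      Ck k fx & Ck k fz].
Proof.
split.
- move=> [cf [dx dz Dx Dz]]; split; first exact: cf.
  exists (fun p => 'D_ex f p), (fun p => 'D_ez f p); split.
  + by move=> p; apply: derivableP; exact: dx.
  + by move=> p; apply: derivableP; exact: dz.
  + exact: Dx.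
  + exact: Dz.
- move=> [cf [fx [fz [dx dz Dx Dz]]]]; split; first exact: cf.
  have Ex : (fun p => 'D_ex f p) = fx by apply/funext => p; exact: derive_val.
  have Ez : (fun p => 'D_ez f p) = fz by apply/funext => p; exact: derive_val.
  split; [move=> p; exact: ex_derive|move=> p; exact: ex_derive|..].
  + by rewrite Ex; exact: Dx.
  + by rewrite Ez; exact: Dz.
Qed.

Lemma is_derive_lin a b f g p e df dg : is_derive p e f df ->
  is_derive p e g dg ->
  is_derive p e (fun q => a * f q + b * g q) (a * df + b * dg).
Proof. by move=> Hf Hg; apply: is_deriveD; apply: is_deriveZ. Qed.

Lemma continuous_lin {T : topologicalType} a b (f g : T -> R) : continuous f ->
  continuous g -> continuous (fun q => a * f q + b * g q).
Proof.
move=> cf cg p; apply: cvgD; apply: cvgM; [exact: cvg_cst|exact: cf|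
  exact: cvg_cst|exact: cg].
Qed.

Lemma Ck_lin k a b f g : Ck k f -> Ck k g -> Ck k (fun p => a * f p + b * g p).
Proof.
elim: k f g => [|k IH] f g.
  by move=> [cf _] [cg _]; split; first exact: continuous_lin.
move=> /CkSP[cf [fx [fz [dfx dfz Fx Fz]]]] /CkSP[cg [gx [gz [dgx dgz Gx Gz]]]].
apply/CkSP; split; first exact: continuous_lin.
exists (fun p => a * fx p + b * gx p), (fun p => a * fz p + b * gz p); split.
- by move=> p; exact: is_derive_lin (dfx p) (dgx p).
- by move=> p; exact: is_derive_lin (dfz p) (dgz p).
- exact: IH Fx Gx.
- exact: IH Fz Gz.
Qed.

(** The factors [1] give the derivative the shape handled by [Ck_lin], which closes the induction of
    [CkM]. *)
Lemma is_derive_mul f g p e df dg : is_derive p e f df -> is_derive p e g dg ->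
  is_derive p e (fun q => f q * g q) (1 * (f p * dg) + 1 * (g p * df)).
Proof.
by move=> Hf Hg; rewrite !mul1r; exact: (is_deriveM Hf Hg).
Qed.

Lemma CkM k f g : Ck k f -> Ck k g -> Ck k (fun p => f p * g p).
Proof.
elim: k f g => [|k IH] f g.
  move=> [cf _] [cg _]; split; last exact: I.
  by move=> p; apply: cvgM; [exact: cf|exact: cg].
move=> Hf Hg; have Cf := CkS Hf; have Cg := CkS Hg.
have /CkSP[cf [fx [fz [dfx dfz Fx Fz]]]] := Hf.
have /CkSP[cg [gx [gz [dgx dgz Gx Gz]]]] := Hg.
apply/CkSP; split; first by move=> p; apply: cvgM; [exact: cf|exact: cg].
exists (fun p => 1 * (f p * gx p) + 1 * (g p * fx p)),
  (fun p => 1 * (f p * gz p) + 1 * (g p * fz p)); split.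
- by move=> p; exact: is_derive_mul (dfx p) (dgx p).
- by move=> p; exact: is_derive_mul (dfz p) (dgz p).
- exact: Ck_lin (IH _ _ Cf Gx) (IH _ _ Cg Fx).
- exact: Ck_lin (IH _ _ Cf Gz) (IH _ _ Cg Fz).
Qed.

Lemma smooth_lin a b f g : smooth f -> smooth g ->
  smooth (fun p => a * f p + b * g p).
Proof. by move=> sf sg k; exact: Ck_lin. Qed.

Definition refl p : R * R := (- p.1, p.2).

Lemma reflK : involutive refl.
Proof. by case=> x z; rewrite /refl/= opprK. Qed.

Lemma refl_continuous : continuous refl.
Proof.
move=> [a b]; apply: (@cvg_pair _ _ _ _ (nbhs (- a)) (nbhs b)) => /=.
  by apply: cvgN; exact: cvg_fst.
exact: cvg_snd.
Qed.

Lemma Ck_refl k f : Ck k f -> Ck k (f \o refl).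
Proof.
elim: k f => [|k IH] f.
  move=> [cf _]; split; last exact: I.
  by move=> p; apply: continuous_comp; [exact: refl_continuous|exact: cf].
move=> /CkSP[cf [fx [fz [dx dz Fx Fz]]]]; apply/CkSP; split.
  by move=> p; apply: continuous_comp; [exact: refl_continuous|exact: cf].
(* The null second terms put the sign change into the shape of [Ck_lin]; the projections below use
   the same device. *)
exists (fun p => -1 * (fx \o refl) p + 0 * (fx \o refl) p),
  (fun p => 1 * (fz \o refl) p + 0 * (fz \o refl) p); split.
- move=> p; rewrite mul0r addr0; apply: (@is_derive_comp_affine _ _ _ _ _ _ ex) => //.
  by move=> t; apply/pair_equal_spec; rewrite /refl/= /GRing.scale/=; split; ring.
- move=> p; rewrite mul0r addr0; apply: (@is_derive_comp_affine _ _ _ _ _ _ ez) => //.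
  by move=> t; apply/pair_equal_spec; rewrite /refl/= /GRing.scale/=; split; ring.
- exact: Ck_lin (IH _ Fx) (IH _ Fx).
- exact: Ck_lin (IH _ Fz) (IH _ Fz).
Qed.

Lemma smooth_refl f : smooth f -> smooth (f \o refl).
Proof. by move=> sf k; exact: Ck_refl. Qed.

Fixpoint C1k (k : nat) (u : R -> R) : Prop :=
  if k is k'.+1 then exists2 du, (forall x : R, is_derive x 1 u (du x)) & C1k k' du
  else continuous u.

Lemma is_derive_continuous (u du : R -> R) :
  (forall x : R, is_derive x 1 u (du x)) -> continuous u.
Proof.
move=> du_ x; apply: differentiable_continuous; apply/derivable1_diffP.
exact: ex_derive.
Qed.

Lemma C1kS k u : C1k k.+1 u -> C1k k u.
Proof.
elim: k u => [|k IH] u; first by move=> [du /is_derive_continuous].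
by move=> [du H Hdu]; exists du => //; exact: IH.
Qed.

Lemma C1k_continuous k u : C1k k u -> continuous u.
Proof. by elim: k u => [//|k IH] u /C1kS; exact: IH. Qed.

Lemma C1k_lin k a b u w : C1k k u -> C1k k w -> C1k k (fun x => a * u x + b * w x).
Proof.
elim: k u w => [|k IH] u w.
  move=> cu cw x; apply: cvgD; apply: cvgM; [exact: cvg_cst|exact: cu|
    exact: cvg_cst|exact: cw].
move=> [du Hu Cu] [dw Hw Cw].
exists (fun x => a * du x + b * dw x); last exact: IH.
move=> x; rewrite (_ : (fun x => _) = a *: u + b *: w); last by apply/funext.
have := Hu x; have := Hw x => ? ?.
exact: is_deriveD.
Qed.

Lemma C1kM k u w : C1k k u -> C1k k w -> C1k k (fun x => u x * w x).
Proof.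
elim: k u w => [|k IH] u w Cu Cw.
  by move=> x; apply: cvgM; [exact: Cu|exact: Cw].
have [du Hu Cu'] := Cu; have [dw Hw Cw'] := Cw.
exists (fun x => 1 * (u x * dw x) + 1 * (w x * du x)).
  move=> x; rewrite !mul1r; have := Hu x; have := Hw x => ? ?.
  by apply: is_deriveM.
by apply: C1k_lin; apply: IH => //; exact: C1kS.
Qed.

Lemma C1k_cst k (c : R) : C1k k (fun=> c).
Proof.
elim: k c => [|k IH] c; first by move=> x; exact: cvg_cst.
by exists (fun=> 0); last exact: IH; move=> x; exact: is_derive_cst.
Qed.

Lemma C1k_id k : C1k k (fun x : R => x).
Proof.
case: k => [|k]; first by move=> x; exact: cvg_id.
by exists (fun=> 1); last exact: C1k_cst; move=> x; exact: is_derive_id.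
Qed.

Lemma C1k_affine k u (a b : R) : C1k k u -> C1k k (fun x => u (a * x + b)).
Proof.
elim: k u => [|k IH] u.
  move=> cu x; apply: (@continuous_comp _ _ _ (fun x => a * x + b) u); last exact: cu.
  by apply: cvgD; [apply: cvgM; [exact: cvg_cst|exact: cvg_id]|exact: cvg_cst].
move=> [du Hu Cu].
exists (fun x => a * du (a * x + b) + 0 * du (a * x + b)).
  move=> x; rewrite mul0r addr0 mulrC; have Hux := Hu (a * x + b).
  apply: (@is_derive1_comp _ u (fun x => a * x + b)).
  rewrite -[X in is_derive _ _ _ X](_ : a *: 1 + 0 = a); last by rewrite addr0 /GRing.scale/= mulr1.
  exact: is_deriveD.
by apply: C1k_lin; exact: IH.
Qed.

Lemma Ck_fst k u : C1k k u -> Ck k (fun p => u p.1).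
Proof.
elim: k u => [|k IH] u.
  move=> cu; split; last exact: I.
  by move=> p; apply: (@continuous_comp _ _ _ fst u); [exact: cvg_fst|exact: cu].
move=> Hu; have [du Hdu Cu] := Hu; apply/CkSP; split.
  move=> p; apply: (@continuous_comp _ _ _ fst u); first exact: cvg_fst.
  exact: C1k_continuous Hu _.
exists (fun p => 1 * (fun p => du p.1) p + 0 * (fun p => du p.1) p),
  (fun p => 0 * (fun p => du p.1) p + 0 * (fun p => du p.1) p); split.
- move=> p; rewrite mul0r addr0.
  apply: (is_derive_comp_affine _ (Hdu p.1)).
  by move=> t /=; rewrite mul1r.
- move=> p; rewrite [X in X + _]mul0r add0r.
  apply: (is_derive_comp_affine _ (Hdu p.1)).
  by move=> t /=; rewrite mul0r scale0r scaler0.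
- exact: Ck_lin (IH _ Cu) (IH _ Cu).
- exact: Ck_lin (IH _ Cu) (IH _ Cu).
Qed.

Lemma Ck_snd k u : C1k k u -> Ck k (fun p => u p.2).
Proof.
elim: k u => [|k IH] u.
  move=> cu; split; last exact: I.
  by move=> p; apply: (@continuous_comp _ _ _ snd u); [exact: cvg_snd|exact: cu].
move=> Hu; have [du Hdu Cu] := Hu; apply/CkSP; split.
  move=> p; apply: (@continuous_comp _ _ _ snd u); first exact: cvg_snd.
  exact: C1k_continuous Hu _.
exists (fun p => 0 * (fun p => du p.2) p + 0 * (fun p => du p.2) p),
  (fun p => 1 * (fun p => du p.2) p + 0 * (fun p => du p.2) p); split.
- move=> p; rewrite [X in X + _]mul0r add0r.
  apply: (is_derive_comp_affine _ (Hdu p.2)).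
  by move=> t /=; rewrite mul0r scale0r scaler0.
- move=> p; rewrite mul0r addr0.
  apply: (is_derive_comp_affine _ (Hdu p.2)).
  by move=> t /=; rewrite mul1r.
- exact: Ck_lin (IH _ Cu) (IH _ Cu).
- exact: Ck_lin (IH _ Cu) (IH _ Cu).
Qed.

End smooth_calculus.

(** * Smooth bumps on an interval *)

Section bump.
Context {R : realType}.
Implicit Types (n k : nat) (x a c : R).

(* [x^-n e^{-1/x}] for [x > 0]; this family is stable under differentiation up
   to linear combinations, which gives the smoothness of [e^{-1/x}]. *)
Definition flat n x : R := if 0 < x then (x^-1) ^+ n * expR (- x^-1) else 0.

Lemma flat_ge0 n x : 0 <= flat n x.
Proof.
rewrite /flat; case: ifP => // x0.
by rewrite mulr_ge0 ?expR_ge0// exprn_ge0// invr_ge0 ltW.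
Qed.

(** [e^t >= t^(n+1) / (n+1)!] at [t = 1/x]. This decay at [0] yields the derivative there. *)
Lemma flat_le n x : 0 <= x -> flat n x <= n.+1`!%:R * x.
Proof.
rewrite /flat => x0; case: ifP => [{}x0|_]; last by rewrite mulr_ge0.
have t0 : 0 < x^-1 by rewrite invr_gt0.
rewrite expRN ler_pdivrMr ?expR_gt0//.
have F0 : 0 < n.+1`!%:R :> R by rewrite ltr0n fact_gt0.
have := expR_ge1Dxn n (ltW t0) => H.
have : n.+1`!%:R * x * (x^-1 ^+ n.+1 / n.+1`!%:R) <= n.+1`!%:R * x * expR x^-1.
  by rewrite ler_pM2l ?mulr_gt0//; apply: le_trans H; rewrite lerDr.
apply: le_trans; rewrite exprS le_eqVlt; apply/orP; left; apply/eqP.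
by field; rewrite !gt_eqF.
Qed.

Lemma flat_mulV n x : x^-1 * flat n x = flat n.+1 x.
Proof. by rewrite /flat; case: ifP => _; rewrite ?mulr0// exprS mulrA. Qed.

Lemma is_derive_flat n x :
  is_derive x 1 (flat n) (- n%:R * flat n.+1 x + 1 * flat n.+2 x).
Proof.
have [x0|x0|->] := ltgtP x 0.
- rewrite {2 3}/flat ltNge (ltW x0)/= !mulr0 addr0.
  apply: (@near_eq_is_derive R R R (cst 0)).
  near=> y; rewrite /flat ltNge; suff -> : y <= 0 by [].
  by apply/ltW; near: y; exact: lt_nbhsl.
- rewrite /flat x0.
  pose F (y : R) : R := (y^-1) ^+ n * expR (- y^-1).
  apply: (@near_eq_is_derive R R R F).
    near=> y; rewrite /F; suff -> : 0 < y by [].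
    by near: y; exact: lt_nbhsr.
  have xn0 : x != 0 by rewrite gt_eqF.
  have dV : is_derive x 1 (fun y : R => y^-1) (- x ^- 2).
    have := @is_deriveV R id x 1 1 xn0 (is_derive_id _ _).
    by rewrite /GRing.scale/= mulr1.
  have dN : is_derive x 1 (fun y : R => - y^-1) (x ^- 2).
    by have := is_deriveN dV; rewrite opprK.
  have dE : is_derive x 1 (fun y : R => expR (- y^-1)) (expR (- x^-1) * x ^- 2).
    exact: (is_derive1_comp (is_derive_expR _) dN).
  have dX : is_derive x 1 (fun y : R => (y^-1) ^+ n) (- n%:R * x^-1 ^+ n.+1).
    case: (n) => [|m]; first by rewrite oppr0 mul0r; exact: is_derive_cst.
    have := is_deriveX m.+1 dV; rewrite /GRing.scale/= exprfctE; congr is_derive.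
    by rewrite -exprVn !exprS; ring.
  have := is_deriveM dX dE; rewrite /GRing.scale/=; congr is_derive.
  by rewrite -exprVn !exprS; ring.
(* At [0] the difference quotient of [flat n] is [flat n.+1], which is [O(h)] for [h > 0] and zero
   for [h <= 0]. *)
- have f00 m : flat m 0 = 0 by rewrite /flat ltxx.
  rewrite !f00 !mulr0 addr0; apply/is_deriveP.
  apply/cvgr0Pnorm_le => e e0; near=> h.
  have hn0 : h != 0 by near: h; exact: nbhs_dnbhs_neq.
  rewrite f00 addr0 subr0 /GRing.scale/= mulr1 flat_mulV ger0_norm ?flat_ge0//.
  have [h0|h0] := leP h 0; first by rewrite /flat ltNge h0/= ltW.
  apply: le_trans (flat_le _ (ltW h0)) _.
  have F0 : 0 < n.+2`!%:R :> R by rewrite ltr0n fact_gt0.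
  rewrite mulrC -ler_pdivlMr//; apply: le_trans (ler_norm h) _.
  by near: h; apply: dnbhs0_le; rewrite divr_gt0.
Unshelve. all: by end_near. Qed.

Lemma C1k_flat k n : C1k k (flat n).
Proof.
elim: k n => [|k IH] n.
  by apply: is_derive_continuous; exact: is_derive_flat.
exists (fun x => - n%:R * flat n.+1 x + 1 * flat n.+2 x).
  exact: is_derive_flat.
by apply: C1k_lin; exact: IH.
Qed.

Lemma flat_le1 x : flat 0 x <= 1.
Proof.
rewrite /flat; case: ifP => // x0; rewrite expr0 mul1r -expR0 ler_expR.
by rewrite oppr_le0 invr_ge0 ltW.
Qed.

Lemma flat0_neq0 x : (flat 0 x != 0) = (0 < x).
Proof.
rewrite /flat; case: ifP => x0; last by rewrite eqxx.
by rewrite expr0 mul1r gt_eqF// expR_gt0.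
Qed.

(** The arguments are [n (x - a) - 1] and [n (c - x) - 1], expanded to the affine form of
    [C1k_affine]. The shift by [1] keeps the support at distance [1/n] inside []a, c[], while both
    arguments tend to infinity at each point of that interval. *)
Definition cutoff a c n x : R :=
  flat 0 (n%:R * x + (- (n%:R * a) - 1)) * flat 0 (- n%:R * x + (n%:R * c - 1)).

Lemma C1k_cutoff k a c n : C1k k (cutoff a c n).
Proof. by apply: C1kM; apply: (C1k_affine _ _ (C1k_flat k 0)). Qed.

Lemma cutoff_ge0 a c n x : 0 <= cutoff a c n x.
Proof. by rewrite mulr_ge0// flat_ge0. Qed.

Lemma cutoff_le1 a c n x : cutoff a c n x <= 1.
Proof. by rewrite mulr_ile1// ?flat_ge0// flat_le1. Qed.

Lemma cutoff_neq0 a c n x : cutoff a c n.+1 x != 0 ->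
  a + n.+1%:R^-1 <= x <= c - n.+1%:R^-1.
Proof.
rewrite mulf_eq0 negb_or !flat0_neq0 => /andP[H1 H2].
have n0 : 0 < n.+1%:R :> R by [].
have E : n.+1%:R * n.+1%:R^-1 = 1 :> R by rewrite divff// gt_eqF.
apply/andP; split; rewrite -(ler_pM2l n0) ?mulrDr ?mulrN E; lra.
Qed.

Lemma cvg_flat0 (s t : R) : 0 < s -> flat 0 (n%:R * s + t) @[n --> \oo] --> (1 : R).
Proof.
move=> s0.
(* [e^(-1/y) >= 1 - 1/y], and [y = n s + t] is eventually at least [n s / 2]. *)
apply: (@squeeze_cvgr _ _ _ _ (fun n : nat => 1 - (2 / s) * n%:R^-1) (fun=> 1)).
- near=> n.
  have n0 : 0 < n%:R :> R by rewrite ltr0n; near: n; exact: nbhs_infty_gt.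
  have nst : n%:R * s / 2 <= n%:R * s + t.
    suff : - (2 * t) / s <= n%:R by rewrite ler_pdivrMr//; lra.
    by near: n; exact: nbhs_infty_ger.
  have ns0 : 0 < n%:R * s / 2 by rewrite divr_gt0// mulr_gt0.
  have t0 : 0 < n%:R * s + t by exact: lt_le_trans nst.
  rewrite flat_le1 andbT /flat t0 expr0 mul1r.
  apply: le_trans (expR_ge1Dx _); rewrite lerD2l lerN2.
  have -> : 2 / s / n%:R = (n%:R * s / 2)^-1 by field; rewrite !gt_eqF.
  by rewrite lef_pV2 ?posrE.
- rewrite -[X in _ --> X]subr0 -[X in _ - X](mulr0 (2 / s)).
  apply: cvgB; first exact: cvg_cst.
  apply: cvgM; first exact: cvg_cst.
  apply: (proj2 (gtr0_cvgV0 _) cvgr_idn).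
  by near=> n; rewrite ltr0n; near: n; exact: nbhs_infty_gt.
- exact: cvg_cst.
Unshelve. all: by end_near. Qed.

Lemma cvg_cutoff a c x :
  cutoff a c n x @[n --> \oo] --> (\1_`]a, c[%classic x : R).
Proof.
rewrite indicE mem_setE in_itv/=.
have [ax|ax] := ltP a x; last first.
  apply: (@cvg_near_cst _ _ (0 : R)); apply: nearW => n; apply/eqP.
  rewrite /cutoff {1}/flat ltNge [X in ~~ X](_ : _ = true) ?mul0r//.
  have : n%:R * (x - a) <= 0 by rewrite mulr_ge0_le0// subr_le0.
  by move=> H; apply/idP; lra.
have [xc|xc] := ltP x c; last first.
  apply: (@cvg_near_cst _ _ (0 : R)); apply: nearW => n; apply/eqP.
  rewrite /cutoff [X in _ * X]/flat ltNge [X in ~~ X](_ : _ = true) ?mulr0//.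
  have : n%:R * (c - x) <= 0 by rewrite mulr_ge0_le0// subr_le0.
  by move=> H; apply/idP; lra.
rewrite -[X in _ --> X]mulr1; apply: cvgM.
- rewrite (_ : (fun n => _) = fun n => flat 0 (n%:R * (x - a) + (- 1))).
    by apply: cvg_flat0; rewrite subr_gt0.
  by apply/funext => n; congr flat; ring.
- rewrite (_ : (fun n => _) = fun n => flat 0 (n%:R * (c - x) + (- 1))).
    by apply: cvg_flat0; rewrite subr_gt0.
  by apply/funext => n; congr flat; ring.
Qed.

End bump.

(** * Borel measurability of continuous functions on the plane *)

Section measurable_continuous.
Context {R : realType}.

(** The product sigma-algebra is generated by measurable rectangles, so the open set is written as a
    countable union of boxes with rational centre and radius. *)
Lemma open_measurable2 (U : set (R * R)) : open U ->
  measurable (U : set (measurableTypeR R * measurableTypeR R)).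
Proof.
move=> oU.
pose box (q : rat * rat * rat) : set (R * R) :=
  `](ratr q.1.1 - ratr q.2), (ratr q.1.1 + ratr q.2)[ `*`
  `](ratr q.1.2 - ratr q.2), (ratr q.1.2 + ratr q.2)[.
have -> : U = \bigcup_(q in [set q | box q `<=` U]) box q.
  apply/seteqP; split => [[x z] Up|p [q /= qU]]; last exact: qU.
  have [e e0 He] : exists2 e : R, 0 < e & ball (x, z) e `<=` U.
    have := oU; rewrite openE => /(_ _ Up) /nbhs_ballP[e e0 He].
    by exists e.
  (* The centre is taken within [r] of the point and the box has radius [r], so the box stays within
     [2 r < e]. *)
  have [r /andP[r0 re]] : exists r : rat, (0 : R) < ratr r < e / 2.
    have /rat_in_itvoo[r] : (0 : R) < e / 2 by rewrite divr_gt0.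
    by rewrite in_itv/=; exists r.
  have near_rat (y : R) : exists q : rat, y - ratr r < ratr q < y + ratr r.
    have /rat_in_itvoo[q] : y - ratr r < y + ratr r by rewrite ltrD2l; lra.
    by rewrite in_itv/=; exists q.
  have [q1 /andP[q1l q1r]] := near_rat x; have [q2 /andP[q2l q2r]] := near_rat z.
  exists (q1, q2, r); last by split; rewrite /= in_itv/=; apply/andP; split; lra.
  move=> [y w]; rewrite /box/= => -[]; rewrite !in_itv/= => /andP[? ?] /andP[? ?].
  by apply: He; split; rewrite /ball/= ltr_norml; apply/andP; split; lra.
rewrite bigcup_mkcond; apply: countable_bigcupT_measurable.
  exact: countableP.
move=> q; case: ifPn => _; last exact: measurable0.
by apply: measurableX; exact: measurable_itv.
Qed.

Lemma continuous_measurable2 (f : R * R -> R) (D : set (R * R)) :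
  continuous f ->
  measurable_fun (D : set (measurableTypeR R * measurableTypeR R)) f.
Proof.
move=> cf; apply: (@measurable_funS _ _ _ _ setT) => //.
apply: (measurability _ (RGenOInfty.measurableE R)).
move=> _ [_ [a ->] <-]; rewrite setTI; apply: open_measurable2.
apply: open_comp; first by move=> p _; exact: cf.
by rewrite set_itvE; exact: open_gt.
Qed.

End measurable_continuous.

(** * Uniqueness of weak derivatives *)

Section dynkin_integral.
Local Open Scope ereal_scope.
Context d d' (T : measurableType d) (T' : measurableType d') (R : realType)
  (mu : {measure set T -> \bar R}).

(** The sets [S] whose preimage carries zero integral form a Dynkin system; complements use the zero
    total over [D]. The map [h] is successively [fst], [snd] and [id], which extends the vanishing
    to one coordinate, to both, and then from rectangles to all measurable sets. *)
Lemma dynkin_integral0 (D : set T) (g : T -> R) (h : T -> T')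
    (G : set (set T')) : measurable D -> mu.-integrable D (EFin \o g) ->
  measurable_fun setT h -> d'.-measurable = <<s G >> -> setI_closed G ->
  \int[mu]_(x in D) (g x)%:E = 0 ->
  (forall S, G S -> \int[mu]_(x in D `&` h @^-1` S) (g x)%:E = 0) ->
  forall S, measurable S -> \int[mu]_(x in D `&` h @^-1` S) (g x)%:E = 0.
Proof.
move=> mD ig mh GE IG gD gG S.
have mhS A : measurable A -> measurable (h @^-1` A).
  by move=> mA; rewrite -[X in measurable X]setTI; exact: mh.
have mDS A : measurable A -> measurable (D `&` h @^-1` A).
  by move=> mA; apply: measurableI => //; exact: mhS.
have igS A : measurable A -> mu.-integrable (D `&` h @^-1` A) (EFin \o g).
  by move=> mA; apply: integrableS ig => //; exact: mDS.
rewrite [X in X S]GE => mS.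
apply: (@dynkin_induction _ _ G
  [set S | \int[mu]_(x in D `&` h @^-1` S) (g x)%:E = 0] GE IG _ _ _ _ S mS).
- by rewrite /= preimage_setT setIT.
- exact: gG.
- move=> A mA /= A0; move: gD.
  have E : D = (D `&` h @^-1` A) `|` (D `&` h @^-1` (~` A)).
    by rewrite preimage_setC -setIUr setUv setIT.
  rewrite {1}E integral_setU.
  + by rewrite A0 add0e.
  + exact: mDS.
  + by apply: mDS; exact: measurableC.
  + by rewrite -E; exact: (measurable_int _ ig).
  + by apply/disj_setPS => x [[_ ?] [_ ?]].
- move=> F mF tF F0 /=; rewrite preimage_bigcup setI_bigcupr integral_bigcup//.
  + by apply: eseries0 => n _ _; exact: F0.
  + apply/trivIsetP => i j _ _ ij; apply/seteqP; split => // x [[_ xi] [_ xj]].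
    by have /trivIsetP/(_ i j I I ij)/seteqP[+ _] := tF; move=> /(_ (h x)); apply.
  + by move=> k; exact: mDS.
  + rewrite -setI_bigcupr -preimage_bigcup; apply: igS.
    by apply: bigcupT_measurable.
Qed.

End dynkin_integral.

Section rays.
Context {R : realType}.

Lemma setI_closed_rays : setI_closed (@RGenOInfty.G R).
Proof.
move=> _ _ [a ->] [b ->]; exists (Num.max a b).
by apply/seteqP; split=> x /=; rewrite !in_itv/= !andbT gt_max => /andP.
Qed.

Lemma measurable_rays :
  @measurable _ (measurableTypeR R) = <<s @RGenOInfty.G R >>.
Proof. exact: RGenOInfty.measurableE. Qed.

End rays.

Section box.
Context {R : realType} (L T : R).
Local Notation Om := (Omega L T).
Local Notation leb := (@lebesgue_measure R).

Lemma measurable_Omega :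
  measurable (Om : set (measurableTypeR R * measurableTypeR R)).
Proof. by apply: measurableX; exact: measurable_itv. Qed.

Lemma OmegaP p : Om p <-> - (L / 2) < p.1 < L / 2 /\ 0 < p.2 < T.
Proof. by rewrite /Omega /= !in_itv/=. Qed.

Lemma leb2_Omega : 0 < L -> 0 < T -> leb2 Om = (L * T)%:E.
Proof.
move=> L0 T0; rewrite /leb2/= product_measure1E ?measurable_itv//=.
rewrite !lebesgue_measure_itv/= !lte_fin T0 ifT; last by lra.
by rewrite -EFinM; congr EFin; lra.
Qed.

Lemma leb2_Omega_lty : (leb2 Om < +oo)%E.
Proof.
rewrite /leb2/= product_measure1E ?measurable_itv//= !lebesgue_measure_itv/=.
by do 2 case: ifP => _; rewrite ?mule0 ?mul0e ?ltry// -?EFinD -?EFinM ltry.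
Qed.

(** The support lies in the closed rectangle shrunk by [1/(n+1)] on each side, which is compact and
    contained in the open box. *)
Lemma test_fun_cutoff (a c a' c' : R) n : - (L / 2) <= a -> c <= L / 2 ->
  0 <= a' -> c' <= T ->
  test_fun Om (fun p => cutoff a c n.+1 p.1 * cutoff a' c' n.+1 p.2).
Proof.
move=> La cL a0 cT.
set phi := fun p => _.
pose K : set (R * R) := `[a + n.+1%:R^-1, c - n.+1%:R^-1] `*`
  `[a' + n.+1%:R^-1, c' - n.+1%:R^-1].
have n0 : 0 < n.+1%:R^-1 :> R by rewrite invr_gt0.
have cK : compact K by apply: compact_setX; exact: segment_compact.
have sK : closure [set p | phi p != 0] `<=` K.
  have -> : K = closure K.
    by apply/closure_id; apply: compact_closed => //; exact: norm_hausdorff.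
  apply: closure_subset => -[x z] /=; rewrite /phi/= mulf_eq0 negb_or.
  by move=> /andP[/cutoff_neq0 H1 /cutoff_neq0 H2]; split; rewrite /= in_itv.
split.
- move=> k; apply: CkM.
    by apply: (@Ck_fst _ k (cutoff a c n.+1)); exact: C1k_cutoff.
  by apply: (@Ck_snd _ k (cutoff a' c' n.+1)); exact: C1k_cutoff.
- apply: subclosed_compact cK sK; exact: closed_closure.
- apply: subset_trans sK _.
  suff KO (x z : R) : K (x, z) -> Om (x, z) by move=> [x z]; exact: KO.
  rewrite /K /= !in_itv/=; set r := _^-1 in n0 * => -[/andP[? ?] /andP[? ?]].
  by apply/OmegaP; split; apply/andP; split => /=; lra.
Qed.

Lemma integral_rect_eq0 (g : R * R -> R) (a c a' c' : R) :
  measurable_fun (Om : set (measurableTypeR R * measurableTypeR R)) g ->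
  leb2.-integrable Om (EFin \o g) ->
  (forall phi, test_fun Om phi -> \int[leb2]_(p in Om) (g p * phi p) = 0) ->
  - (L / 2) <= a -> c <= L / 2 -> 0 <= a' -> c' <= T ->
  (\int[leb2]_(p in `]a, c[ `*` `]a', c'[) (g p)%:E = 0)%E.
Proof.
move=> mg ig g0 La cL a0 cT.
have sub : `]a, c[ `*` `]a', c'[ `<=` Om.
  move=> [x z] [/=]; rewrite !in_itv/= => /andP[? ?] /andP[? ?].
  by apply/OmegaP; split; apply/andP; split => /=; lra.
have uB n p : `|cutoff a c n.+1 p.1 * cutoff a' c' n.+1 p.2| <= 1.
  rewrite normrM !ger0_norm ?cutoff_ge0//.
  by rewrite mulr_ile1 ?cutoff_ge0 ?cutoff_le1.
pose u n (p : R * R) := cutoff a c n.+1 p.1 * cutoff a' c' n.+1 p.2.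
pose v (p : R * R) : R := \1_(`]a, c[ `*` `]a', c'[) p.
have mu_ n : measurable_fun (Om : set (measurableTypeR R * measurableTypeR R)) (u n).
  apply: continuous_measurable2.
  by have [/(_ 0%N) [cu _] _ _] := test_fun_cutoff n La cL a0 cT.
have mv : measurable_fun (Om : set (measurableTypeR R * measurableTypeR R)) v.
  by apply: measurable_indic; apply: measurableX; exact: measurable_itv.
have iu n : (\int[leb2]_(p in Om) (g p * u n p)%:E = 0)%E.
  have := g0 _ (test_fun_cutoff n La cL a0 cT).
  rewrite /Rintegral => H; rewrite -[LHS]fineK; first by congr EFin.
  apply: integrable_fin_num; first exact: measurable_Omega.
  apply: (@le_integrableR _ _ _ _ _ measurable_Omega _ (fun p => `|g p|)).
  - exact: measurable_funM.
  - by move=> p _; rewrite normrM ler_piMr// uB.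
  - exact: integrable_norm.
have := @dominated_convergence _ _ R leb2 Om measurable_Omega
  (fun n p => (g p * u n p)%:E) (fun p => (g p * v p)%:E) (fun p => `|g p|%:E).
case.
- by move=> n; apply/measurable_EFinP; exact: measurable_funM.
- by apply/measurable_EFinP; exact: measurable_funM.
- apply: aeW => p _; apply: cvg_EFin; first exact: nearW.
  apply: cvgM; first exact: cvg_cst.
  have -> : v p = \1_`]a, c[%classic p.1 * \1_`]a', c'[%classic p.2.
    by rewrite /v !indicE in_setX -natrM mulnb.
  apply: cvgM.
    by have := @cvg_cutoff _ a c p.1; rewrite -cvg_shiftS.
  by have := @cvg_cutoff _ a' c' p.2; rewrite -cvg_shiftS.
- exact: integrable_norm.
- apply: aeW => p n _ /=; rewrite lee_fin.
  by rewrite normrM ler_piMr// uB.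
move=> _ _.
under eq_fun do rewrite iu.
move=> /(cvg_lim (@ereal_hausdorff R)); rewrite lim_cst// => H.
rewrite -(setIidr sub) integral_mkcondr H.
apply: eq_integral => p _; rewrite /v patchE indicE.
by case: ifP; rewrite ?mulr1 ?mulr0.
Qed.

Theorem fundamental_lemma (g : R * R -> R) : 0 < L -> 0 < T ->
  measurable_fun (Om : set (measurableTypeR R * measurableTypeR R)) g ->
  leb2.-integrable Om (EFin \o g) ->
  (forall phi, test_fun Om phi -> \int[leb2]_(p in Om) (g p * phi p) = 0) ->
  {ae leb2, forall p, Om p -> g p = 0}.
Proof.
move=> L0 T0 mg ig g0.
have rect a c a' c' := @integral_rect_eq0 g a c a' c' mg ig g0.
(* A quadrant meets the box in an open rectangle, whose lower corner is a pair of maxima. *)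
have quad a a' : (\int[leb2]_(p in Om `&` (snd @^-1` `]a', +oo[ `&` fst @^-1` `]a, +oo[))
    (g p)%:E = 0)%E.
  rewrite (_ : _ `&` _ = `]Num.max (- (L / 2)) a, L / 2[ `*` `]Num.max 0 a', T[).
    by apply: rect => //; rewrite le_max lexx.
  apply/seteqP; split => [[x z]|[x z]] /=; rewrite !in_itv/= !gt_max ?andbT.
    by move=> [/OmegaP[/= /andP[-> ->] /andP[-> ->]] [-> ->]].
  by move=> [/andP[/andP[? ?] ?] /andP[/andP[? ?] ?]]; split; [apply/OmegaP; split;
    apply/andP|].
have mf : measurable_fun setT (fst : measurableTypeR R * measurableTypeR R -> _).
  exact: measurable_fst.
have ms : measurable_fun setT (snd : measurableTypeR R * measurableTypeR R -> _).
  exact: measurable_snd.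
have preim (h : R * R -> R) A : measurable_fun setT (h : measurableTypeR R * measurableTypeR R -> measurableTypeR R) ->
    measurable (A : set (measurableTypeR R)) ->
    measurable (Om `&` h @^-1` A : set (measurableTypeR R * measurableTypeR R)).
  move=> mh mA; apply: measurableI; first exact: measurable_Omega.
  by rewrite -[X in measurable X]setTI; exact: mh.
have ig' D : measurable (Om `&` D : set (measurableTypeR R * measurableTypeR R)) ->
    leb2.-integrable (Om `&` D) (EFin \o g).
  by move=> mD; apply: integrableS ig => //; exact: measurable_Omega.
have mray a : measurable (`]a, +oo[%classic : set (measurableTypeR R)).
  exact: measurable_itv.
(* A ray that contains a whole edge of the box turns a total integral into an instance of [quad];
   the Dynkin argument needs such a total at each pass. *)
have low : Om `&` fst @^-1` `]-(L/2), +oo[ = Om.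
  by apply/setIidl => -[x z] /OmegaP[/= /andP[? ?] _]; rewrite in_itv/= andbT.
have slow : Om `&` snd @^-1` `]0, +oo[ = Om.
  by apply/setIidl => -[x z] /OmegaP[/= _ /andP[? ?]]; rewrite in_itv/= andbT.
have H1 a' A : measurable (A : set (measurableTypeR R)) ->
    (\int[leb2]_(p in (Om `&` snd @^-1` `]a', +oo[) `&` fst @^-1` A) (g p)%:E = 0)%E.
  move: A; refine (@dynkin_integral0 _ _ (measurableTypeR R * measurableTypeR R)%type
    (measurableTypeR R) R leb2 _ g fst _ _ _ mf measurable_rays
    setI_closed_rays _ _).
  - exact: preim.
  - by apply: ig'; exact: preim.
  - by rewrite -{1}low -setIA [X in _ `&` X]setIC; exact: quad.
  - by move=> _ [a ->]; rewrite -setIA; exact: quad.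
have H2 A B : measurable (A : set (measurableTypeR R)) ->
    measurable (B : set (measurableTypeR R)) ->
    (\int[leb2]_(p in (Om `&` fst @^-1` A) `&` snd @^-1` B) (g p)%:E = 0)%E.
  move=> mA; move: B.
  refine (@dynkin_integral0 _ _ (measurableTypeR R * measurableTypeR R)%type
    (measurableTypeR R) R leb2 _ g snd _ _ _ ms measurable_rays
    setI_closed_rays _ _).
  - exact: preim.
  - by apply: ig'; exact: preim.
  - by rewrite -slow; exact: H1.
  - by move=> _ [a ->]; rewrite setIAC; exact: H1.
have H3 S : measurable (S : set (measurableTypeR R * measurableTypeR R)) ->
    (\int[leb2]_(p in Om `&` S) (g p)%:E = 0)%E.
  move: S; refine (@dynkin_integral0 _ _ (measurableTypeR R * measurableTypeR R)%type
    (measurableTypeR R * measurableTypeR R)%type R leb2 _ g id _ _ _ _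
    (measurable_prod_measurableType _ _) _ _ _).
  - exact: measurable_Omega.
  - exact: ig.
  - exact: measurable_id.
  - move=> _ _ [A mA [B mB <-]] [A' mA' [B' mB' <-]].
    by exists (A `&` A'); [exact: measurableI|exists (B `&` B');
      [exact: measurableI|rewrite setXI]].
  - by have := @H2 setT setT measurableT measurableT; rewrite !preimage_setT !setIT.
  - move=> _ [A mA [B mB <-]]; rewrite -(H2 A B mA mB) -setIA.
    by congr integral.
have : ae_eq leb2 Om (EFin \o g) (cst 0%E).
  apply: integral_ae_eq => //; first exact: measurable_Omega.
  move=> E EO mE; rewrite integral0 -(setIidr EO); exact: H3.
by apply: filterS => p /[apply] -[].
Qed.

Lemma continuous_bounded_Omega (psi : R * R -> R) : continuous psi ->
  exists M : R, forall p, Om p -> `|psi p| <= M.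
Proof.
move=> cpsi.
pose K : set (R * R) := `[- (L / 2), L / 2]%classic `*` `[0, T]%classic.
have cK : compact K by apply: compact_setX; exact: segment_compact.
have cn : {within K, continuous (fun p => `|psi p|)}.
  apply: continuous_subspaceT => p.
  by apply: continuous_comp; [exact: cpsi|exact: norm_continuous].
have [K0|/set0P/negP/negPn/eqP K0] := pselect (K !=set0).
  have [c _ Hc] := compact_EVT_max K0 cK cn.
  exists `|psi c| => -[x z] /OmegaP[/= /andP[? ?] /andP[? ?]]; apply: Hc.
  by rewrite inE; split; rewrite /= in_itv/=; apply/andP; split; apply/ltW.
exists 0 => -[x z] /OmegaP[/= /andP[? ?] /andP[? ?]].
suff : K (x, z) by rewrite K0.
by split; rewrite /= in_itv/=; apply/andP; split; apply/ltW.
Qed.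

Lemma continuous_sqint (psi : R * R -> R) : continuous psi -> sqint leb2 Om psi.
Proof.
move=> cpsi; have [M HM] := continuous_bounded_Omega cpsi.
apply: (@sqint_bounded _ _ _ _ _ measurable_Omega _ M leb2_Omega_lty) => //.
exact: continuous_measurable2.
Qed.

Lemma ae2_imply (P Q : R * R -> Prop) : {ae leb2, forall p, P p} ->
  (forall p, P p -> Q p) -> {ae leb2, forall p, Q p}.
Proof. by move=> HP PQ; apply: (@filterS _ _ (ae_filter_ringOfSetsType leb2) _ _ PQ). Qed.

Lemma ae2_imply2 (P Q S : R * R -> Prop) : {ae leb2, forall p, P p} ->
  {ae leb2, forall p, Q p} ->
  (forall p, P p -> Q p -> S p) -> {ae leb2, forall p, S p}.
Proof.
by move=> HP HQ H; apply: (@filterS2 _ _ (ae_filter_ringOfSetsType leb2) _ _ _ H).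
Qed.

Lemma sqint_integrable f : sqint leb2 Om f -> leb2.-integrable Om (EFin \o f).
Proof.
move=> sf.
have s1 : sqint leb2 Om (fun=> 1 : R).
  apply: (@sqint_bounded _ _ _ _ _ measurable_Omega _ 1 leb2_Omega_lty) => //.
  by move=> x _; rewrite normr1.
have := sqint_mul measurable_Omega sf s1; congr integrable.
by apply/funext => x /=; rewrite mulr1.
Qed.

Lemma weak_derive_unique e f g1 g2 : 0 < L -> 0 < T ->
  weak_derive Om e f g1 -> weak_derive Om e f g2 ->
  {ae leb2, forall p, Om p -> g1 p = g2 p}.
Proof.
move=> L0 T0 [s1 H1] [s2 H2].
have sd := sqintB measurable_Omega s1 s2.
have : {ae leb2, forall p, Om p -> g1 p - g2 p = 0}.
  apply: fundamental_lemma => //; first by have [] := sd.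
    exact: sqint_integrable.
  move=> phi tphi; have := H1 _ tphi; rewrite H2// => /oppr_inj E.
  have cphi : continuous phi by have [/(_ 0%N) []] := tphi.
  have sphi := continuous_sqint cphi.
  have := ip_linl measurable_Omega 1 (-1) s1 s2 sphi; rewrite /ip E mul1r mulN1r subrr.
  by move=> <-; apply: eq_Rintegral => p _; congr (_ * _); rewrite mul1r mulN1r.
by move=> H; apply: (ae2_imply H) => p /[apply] /eqP; rewrite subr_eq0 => /eqP.
Qed.

End box.

(** * Divergence theorem and Poincare inequality *)

Section fubini_G.
Local Open Scope ereal_scope.
Context d1 d2 (T1 : measurableType d1) (T2 : measurableType d2) (R : realType)
  (m1 : {sigma_finite_measure set T1 -> \bar R})
  (m2 : {sigma_finite_measure set T2 -> \bar R}) (f : T1 * T2 -> \bar R).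

Lemma integrable_fubini_G : (m1 \x m2).-integrable setT f ->
  m2.-integrable setT (fubini_G m1 f).
Proof.
move=> If; have mf := measurable_int _ If.
apply/integrableP; split; first exact: measurable_fubini_G If.
apply: le_lt_trans ((integrable21ltyP m1 m2 mf).1 If).
apply: ge0_le_integral; [by []|by []|..].
- by apply: measurableT_comp => //; exact: measurable_fubini_G If.
- apply: (@measurable_fun_fubini_tonelli_G _ _ _ _ _ m1 (abse \o f)).
    exact: measurableT_comp.
  by move=> ?; exact: abse_ge0.
- by move=> y _; apply: le_abse_integral => //; exact: measurableT_comp.
Qed.

End fubini_G.

Lemma Rintegral0_eq d (T : measurableType d) (R : realType)
    (mu : {measure set T -> \bar R}) (D : set T) (f : T -> R) :
  (forall x, D x -> f x = 0) -> \int[mu]_(x in D) f x = 0.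
Proof. by move=> f0; rewrite /Rintegral integral0_eq// => x /f0 ->. Qed.

Section ftc.
Context {R : realType}.

Lemma FTC_open (u du : R -> R) (a b : R) : a < b ->
  (forall x : R, is_derive x 1 u (du x)) -> continuous du ->
  \int[leb1]_(x in `]a, b[) du x = u b - u a.
Proof.
move=> ab Hu cdu; rewrite /Rintegral /leb1.
have mdu (A : set R) : measurable_fun A (EFin \o du).
  apply/measurable_EFinP; apply: (@measurable_funS _ _ _ _ setT) => //.
  exact: continuous_measurable_fun.
rewrite -(@integral_itv_bndoo _ a b (EFin \o du) true false) //.
have cu : continuous u by exact: is_derive_continuous Hu.
rewrite (@continuous_FTC2 _ du u a b ab)//.
- exact: continuous_subspaceT.
- split.
  + by move=> x _; exact: ex_derive.
  + apply: cvg_at_right_filter; exact: cu.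
  + apply: cvg_at_left_filter; exact: cu.
- by move=> x _; rewrite derive1E; exact: derive_val.
Qed.

Lemma continuous_sqint1 (u : R -> R) (a b : R) : continuous u ->
  sqint leb1 `]a, b[%classic u.
Proof.
move=> cu.
have cn : continuous (fun x => `|u x|).
  by move=> x; apply: continuous_comp; [exact: cu|exact: norm_continuous].
have [M HM] : exists M : R, forall x, `]a, b[%classic x -> `|u x| <= M.
  have [ab|ba] := leP a b.
    have [c _ Hc] := EVT_max ab (continuous_subspaceT cn).
    exists `|u c| => x; rewrite /= in_itv/= => /andP[ax xb]; apply: Hc.
    by rewrite in_itv/= !ltW.
  exists 0 => x; rewrite /= in_itv/= => /andP[ax xb]; exfalso.
  by move: (lt_trans ax xb); rewrite ltNge (ltW ba).
apply: (@sqint_bounded _ _ _ _ _ _ _ M) => //.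
- change (@lebesgue_measure R [set` `]a, b[] < +oo)%E.
  rewrite lebesgue_measure_itv/=; case: ifP => _ //.
  by rewrite -EFinD ltry.
- apply: (@measurable_funS _ _ _ _ setT) => //.
  exact: continuous_measurable_fun.
Qed.

End ftc.

Section box.
Context {R : realType} (L T : R).
Local Notation Om := (Omega L T).
Local Notation I := (`]- (L / 2), L / 2[%classic : set (measurableTypeR R)).
Local Notation J := (`]0, T[%classic : set (measurableTypeR R)).
Implicit Types f g : R * R -> R.

Let mOm : measurable (Om : set (measurableTypeR R * measurableTypeR R)).
Proof. exact: measurable_Omega. Qed.
Let mI : measurable I. Proof. exact: measurable_itv. Qed.
Let mJ : measurable J. Proof. exact: measurable_itv. Qed.

Let restrict_Omega_l f x :
  (\int[@lebesgue_measure R]_z ((EFin \o f) \_ Om) (x, z) =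
   ((fun x => \int[@lebesgue_measure R]_(z in J) (f (x, z))%:E) \_ I) x)%E.
Proof.
rewrite patchE; case: ifPn => xI.
  rewrite [RHS]integral_mkcond; apply: eq_integral => z _.
  rewrite !patchE in_setX xI/=.
  by [].
by apply: integral0_eq => z _; rewrite patchE in_setX (negbTE xI).
Qed.

Let restrict_Omega_r f z :
  (\int[@lebesgue_measure R]_x ((EFin \o f) \_ Om) (x, z) =
   ((fun z => \int[@lebesgue_measure R]_(x in I) (f (x, z))%:E) \_ J) z)%E.
Proof.
rewrite patchE; case: ifPn => zJ.
  rewrite [RHS]integral_mkcond; apply: eq_integral => x _.
  rewrite !patchE in_setX zJ/= andbT.
  by [].
by apply: integral0_eq => x _; rewrite patchE in_setX (negbTE zJ) andbF.
Qed.

(** In Fubini's theorem the inner integral may be infinite on a null set of slices, where the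
    real-valued integral is [0] by convention. *)
Let Rintegral_fine (A : set (measurableTypeR R)) (F : R -> \bar R) :
  measurable A -> leb1.-integrable A F ->
  \int[leb1]_(x in A) fine (F x) = fine (\int[leb1]_(x in A) F x)%E.
Proof.
move=> mA iF; congr fine; apply: ae_eq_integral => //.
- apply/measurable_EFinP; apply: measurableT_comp => //.
  exact: (measurable_int _ iF).
- exact: (measurable_int _ iF).
- have := integrable_ae mA iF; apply: filterS => x /[apply] Fx.
  by rewrite fineK.
Qed.

Lemma Fubini_Omega_xz f : leb2.-integrable Om (EFin \o f) ->
  \int[leb2]_(p in Om) f p =
  \int[leb1]_(x in I) \int[leb1]_(z in J) f (x, z).
Proof.
move=> If; have /integrable_mkcond If' := If.
have {}If' := If' (@measurable_Omega R L T).
rewrite /Rintegral integral_mkcond.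
have E1 : (\int[@lebesgue_measure R]_x fubini_F (@lebesgue_measure R)
      ((EFin \o f) \_ Om) x = \int[leb1]_(x in I)
      \int[@lebesgue_measure R]_(z in J) (f (x, z))%:E)%E.
  rewrite [RHS]integral_mkcond; apply: eq_integral => t _.
  exact: restrict_Omega_l.
transitivity (fine (\int[leb1]_(x in I)
      \int[@lebesgue_measure R]_(z in J) (f (x, z))%:E)%E).
  by rewrite -E1; congr fine; exact: (esym (integral12_prod_meas1 If')).
have iF := integrable_fubini_F If'.
have : leb1.-integrable I
    (fun x => \int[@lebesgue_measure R]_(z in J) (f (x, z))%:E)%E.
  apply/integrable_mkcond => //.
  by move: iF; congr integrable; apply/funext => x; exact: restrict_Omega_l.
by move=> /(Rintegral_fine mI) <-.
Qed.

Lemma Fubini_Omega_zx f : leb2.-integrable Om (EFin \o f) ->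
  \int[leb2]_(p in Om) f p =
  \int[leb1]_(z in J) \int[leb1]_(x in I) f (x, z).
Proof.
move=> If; have /integrable_mkcond If' := If.
have {}If' := If' (@measurable_Omega R L T).
rewrite /Rintegral integral_mkcond.
have E1 : (\int[@lebesgue_measure R]_z fubini_G (@lebesgue_measure R)
      ((EFin \o f) \_ Om) z = \int[leb1]_(z in J)
      \int[@lebesgue_measure R]_(x in I) (f (x, z))%:E)%E.
  rewrite [RHS]integral_mkcond; apply: eq_integral => t _.
  exact: restrict_Omega_r.
transitivity (fine (\int[leb1]_(z in J)
      \int[@lebesgue_measure R]_(x in I) (f (x, z))%:E)%E).
  by rewrite -E1; congr fine; exact: (esym (integral21_prod_meas1 If')).
have iF := integrable_fubini_G If'.
have : leb1.-integrable J
    (fun z => \int[@lebesgue_measure R]_(x in I) (f (x, z))%:E)%E.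
  apply/integrable_mkcond => //.
  by move: iF; congr integrable; apply/funext => x; exact: restrict_Omega_r.
by move=> /(Rintegral_fine mJ) <-.
Qed.

Lemma Ck1_ex f x z : Ck 1 f -> is_derive x (1 : R) (fun t => f (t, z)) ('D_ex f (x, z)).
Proof.
move=> [_ [dx _ _ _]].
have : is_derive ((0, z) + x *: ex) ex f ('D_ex f (x, z)).
  have -> : (0, z) + x *: ex = (x, z).
    by apply/pair_equal_spec; rewrite /= /GRing.scale/=; split; ring.
  by apply: derivableP; exact: dx.
move=> /is_derive_line; congr is_derive; apply/funext => t; congr f.
by apply/pair_equal_spec; rewrite /= /GRing.scale/=; split; ring.
Qed.

Lemma Ck1_ez f x z : Ck 1 f -> is_derive z (1 : R) (fun t => f (x, t)) ('D_ez f (x, z)).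
Proof.
move=> [_ [_ dz _ _]].
have : is_derive ((x, 0) + z *: ez) ez f ('D_ez f (x, z)).
  have -> : (x, 0) + z *: ez = (x, z).
    by apply/pair_equal_spec; rewrite /= /GRing.scale/=; split; ring.
  by apply: derivableP; exact: dz.
move=> /is_derive_line; congr is_derive; apply/funext => t; congr f.
by apply/pair_equal_spec; rewrite /= /GRing.scale/=; split; ring.
Qed.

Lemma continuous_slice_l f z : continuous f -> continuous (fun x => f (x, z)).
Proof.
move=> cf x; apply: (@continuous_comp _ _ _ (fun x => (x, z)) f); last exact: cf.
by apply: (@cvg_pair _ _ _ _ (nbhs x) (nbhs z)); [exact: cvg_id|exact: cvg_cst].
Qed.

Lemma continuous_slice_r f x : continuous f -> continuous (fun z => f (x, z)).
Proof.
move=> cf z; apply: (@continuous_comp _ _ _ (fun z => (x, z)) f); last exact: cf.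
by apply: (@cvg_pair _ _ _ _ (nbhs x) (nbhs z)); [exact: cvg_cst|exact: cvg_id].
Qed.

Lemma divergence_ex f : 0 < L -> Ck 1 f ->
  \int[leb2]_(p in Om) 'D_ex f p =
  \int[leb1]_(z in J) (f (L / 2, z) - f (- (L / 2), z)).
Proof.
move=> L0 Cf; have [_ [_ _ [cd _] _]] := Cf.
rewrite Fubini_Omega_zx; last by apply: sqint_integrable; exact: continuous_sqint.
apply: eq_Rintegral => z _.
apply: (@FTC_open _ (fun t => f (t, z)) (fun t => 'D_ex f (t, z))).
- lra.
- by move=> x; exact: Ck1_ex.
- exact: (@continuous_slice_l (fun p => 'D_ex f p) z cd).
Qed.

Lemma divergence_ez f : 0 < T -> Ck 1 f ->
  \int[leb2]_(p in Om) 'D_ez f p =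
  \int[leb1]_(x in I) (f (x, T) - f (x, 0)).
Proof.
move=> T0 Cf; have [_ [_ _ _ [cd _]]] := Cf.
rewrite Fubini_Omega_xz; last by apply: sqint_integrable; exact: continuous_sqint.
apply: eq_Rintegral => x _.
apply: (@FTC_open _ (fun t => f (x, t)) (fun t => 'D_ez f (x, t))).
- exact: T0.
- by move=> z; exact: Ck1_ez.
- exact: (@continuous_slice_r (fun p => 'D_ez f p) x cd).
Qed.

Lemma test_fun_out phi p : test_fun Om phi -> ~ Om p -> phi p = 0.
Proof.
move=> [_ _ s] nO; apply/eqP; apply: contra_notT nO => /= pn0.
by apply: s; exact: subset_closure.
Qed.

(** Divergence theorem for [f * phi], which vanishes on the boundary because a test function is zero
    off the open box, followed by the product rule. *)
Lemma weak_derive_smooth f e : 0 < L -> 0 < T -> e = ex \/ e = ez -> smooth f ->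
  weak_derive Om e f ('D_e f).
Proof.
move=> L0 T0 eE sf.
have cD (g : R * R -> R) : smooth g -> continuous ('D_e g).
  move=> /(_ 1%N) [_ [_ _ [cx _] [cz _]]].
  by case: eE => ->; [exact: cx|exact: cz].
have dD (g : R * R -> R) p : smooth g -> derivable g p e.
  by move=> /(_ 1%N) [_ [dx dz _ _]]; case: eE => ->; [exact: dx|exact: dz].
have sqD := @continuous_sqint R L T _ (cD _ sf).
split; first exact: sqD.
move=> phi tphi; have sphi : smooth phi by have [] := tphi.
have c0 (g : R * R -> R) : smooth g -> sqint leb2 Om g.
  by move=> sg; apply: continuous_sqint; exact: (Ck_continuous (sg 0%N)).
have sqDphi := @continuous_sqint R L T _ (cD _ sphi).
have C1 : Ck 1 (fun p => f p * phi p) by exact: CkM.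
have : \int[leb2]_(p in Om) 'D_e (fun p => f p * phi p) p = 0.
  have out p : ~ Om p -> f p * phi p = 0.
    by move=> nO; rewrite (test_fun_out tphi nO) mulr0.
  case: eE => ->.
  - rewrite divergence_ex//; apply: Rintegral0_eq => z _; rewrite !out ?subrr//.
      by move=> /OmegaP[/= /andP[]]; rewrite ltxx.
    by move=> /OmegaP[/= /andP[_]]; rewrite ltxx.
  - rewrite divergence_ez//; apply: Rintegral0_eq => x _; rewrite !out ?subrr//.
      by move=> /OmegaP[/= _ /andP[]]; rewrite ltxx.
    by move=> /OmegaP[/= _ /andP[_]]; rewrite ltxx.
have <- : \int[leb2]_(p in Om) (1 * (f p * 'D_e phi p) + 1 * ('D_e f p * phi p)) =
    \int[leb2]_(p in Om) 'D_e (fun p => f p * phi p) p.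
  apply: eq_Rintegral => p _.
  have := is_derive_mul (derivableP (dD _ p sf)) (derivableP (dD _ p sphi)).
  by move=> H; rewrite (@derive_val _ _ _ _ _ _ _ H); congr (_ + 1 * _); rewrite mulrC.
rewrite Rintegral_lin.
- by rewrite !mul1r => /eqP; rewrite addr_eq0 => /eqP.
- exact: mOm.
- exact: (sqint_mul mOm (c0 _ sf) sqDphi).
- exact: (sqint_mul mOm sqD (c0 _ sphi)).
Qed.

Lemma smooth_shift_ex (c : R) : smooth (fun p : R * R => p.1 - c).
Proof.
move=> k; apply: (@Ck_fst _ k (fun x => x - c)).
rewrite (_ : (fun x => _) = (fun x => 1 * x + (- c) * 1)).
  by apply: C1k_lin; [exact: C1k_id|exact: C1k_cst].
by apply/funext => x; rewrite mul1r mulr1.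
Qed.

(* Divergence theorem for [(x - L/2) phi^2], which vanishes on the side
   [x = L/2]. *)
Lemma poincare_smooth phi : 0 < L -> smooth phi ->
  ssq leb2 Om phi <= 2 * L * ssq leb1 J (fun z => phi (- (L / 2), z)) +
                     4 * L ^+ 2 * ssq leb2 Om ('D_ex phi).
Proof.
move=> L0 sphi.
have c0 (g : R * R -> R) : smooth g -> sqint leb2 Om g.
  by move=> sg; apply: continuous_sqint; exact: (Ck_continuous (sg 0%N)).
have [_ [dx _ [cD _] _]] := sphi 1%N.
have sD : sqint leb2 Om ('D_ex phi) by exact: continuous_sqint.
have sphi2 := c0 _ sphi.
have sl := smooth_shift_ex (L / 2).
pose w (p : R * R) := (p.1 - L / 2) * 'D_ex phi p.
have sw : sqint leb2 Om w.
  apply: continuous_sqint => p; apply: cvgM; last exact: cD.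
  exact: (Ck_continuous (sl 0%N)).
have sw_le : ssq leb2 Om w <= L ^+ 2 * ssq leb2 Om ('D_ex phi).
  apply: (ssq_le mOm (ltW L0) sw sD).
  move=> p /OmegaP[/andP[? ?] _]; rewrite /w normrM ler_wpM2r//.
  by rewrite ler_norml; apply/andP; split; lra.
pose F (p : R * R) := (p.1 - L / 2) * (phi p * phi p).
have CF : Ck 1 F by exact: CkM (sl 1%N) (CkM (sphi 1%N) (sphi 1%N)).
have DF p : 'D_ex F p = 1 * (phi p ^+ 2) + 2 * (phi p * w p).
  have d1 : is_derive p ex (fun q : R * R => q.1 - L / 2) 1.
    rewrite -[X in is_derive _ _ _ X]mulr1.
    apply: (@is_derive_comp_affine _ _ _ (fun x => x - L / 2) fst p _ 1).
      by move=> t /=; rewrite mul1r.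
    rewrite -[X in is_derive _ _ _ X]subr0.
    exact: is_deriveB.
  have d2 := is_derive_mul d1 (is_derive_mul (derivableP (dx p)) (derivableP (dx p))).
  by rewrite (@derive_val _ _ _ _ _ _ _ d2) /w; ring.
have := divergence_ex L0 CF.
under eq_Rintegral => p _ do rewrite DF.
rewrite (Rintegral_lin mOm 1 2 (sqint_sqr sphi2) (sqint_mul mOm sphi2 sw)).
rewrite -/(ssq leb2 Om phi) -/(ip leb2 Om phi w) mul1r.
under eq_Rintegral => z _.
  rewrite (_ : _ - _ = L * (phi (- (L / 2), z) ^+ 2)); last by rewrite /F /=; field.
  over.
rewrite RintegralZl//; last first.
  apply: sqint_sqr; apply: continuous_sqint1.
  by apply: continuous_slice_r; exact: (Ck_continuous (sphi 0%N)).
rewrite -/(ssq leb1 J _) => E.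
(* Young's inequality: with [a = ssq phi], [b = ip phi w] and [c = ssq w], this square gives
   [-2 b <= a/2 + 2 c]. In the divergence identity [a + 2 b = L * boundary], half of [a] is
   absorbed; doubling produces the constants [2 L] and [4 L^2]. *)
have := ssq_ge0 leb2 Om (fun p => 2^-1 * phi p + 1 * w p).
rewrite (ssq_lin mOm _ _ sphi2 sw).
by move: E sw_le; set a := ssq _ _ _; set b := ip _ _ _ _; set c := ssq _ _ _;
  set d := ssq _ _ _; set e := ssq _ _ _; lra.
Qed.

End box.

Section ssq_extra.
Context d (T : measurableType d) (R : realType)
  (mu : {measure set T -> \bar R}) (D : set T).
Hypothesis mD : measurable D.
Implicit Types f g : T -> R.

Lemma ssq_lin_le a b f g : sqint mu D f -> sqint mu D g ->
  ssq mu D (fun x => a * f x + b * g x) <=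
  2 * a ^+ 2 * ssq mu D f + 2 * b ^+ 2 * ssq mu D g.
Proof.
move=> sf sg.
have := ssqD_le mD (sqintZ mD a sf) (sqintZ mD b sg).
by rewrite !ssqZ// !mulrA.
Qed.

Lemma cvg_ssq0 (g : nat -> T -> R) : (forall n, sqint mu D (g n)) ->
  (\int[mu]_(x in D) (g n x ^+ 2)%:E)%E @[n --> \oo] --> 0%E <->
  (forall e : R, 0 < e -> \forall n \near \oo, ssq mu D (g n) <= e).
Proof.
move=> sg; rewrite -[X in _ --> X]/((0 : R)%:E) fine_cvgP; split.
- move=> [_ /cvgr0Pnorm_le H] e /H; apply: filterS => n.
  by rewrite ger0_norm ?ssq_ge0.
- move=> H; split.
    by apply: nearW => n; rewrite ssqE.
  apply/cvgr0Pnorm_le => e /H; apply: filterS => n.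
  by rewrite ger0_norm ?ssq_ge0.
Qed.

(** The shape is that of a weak derivative, with [h] the derivative of a test function and [k] the
    test function. By Cauchy-Schwarz both sides are continuous in [f] and [g]. *)
Lemma ip_eq_of_approx f g h k : sqint mu D f -> sqint mu D g ->
  sqint mu D h -> sqint mu D k ->
  (forall e : R, 0 < e -> exists f' g', [/\ sqint mu D f', sqint mu D g',
    ssq mu D (fun x => f' x - f x) <= e, ssq mu D (fun x => g' x - g x) <= e &
    ip mu D f' h = - ip mu D g' k]) ->
  ip mu D f h = - ip mu D g k.
Proof.
move=> sf sg sh sk H.
apply/eqP; rewrite -addr_eq0 -sqrf_eq0 eq_le sqr_ge0 andbT.
apply/ler_addgt0Pl => e e0; rewrite addr0.
(* The squared defect is at most [2 (e / C) (ssq h + ssq k) <= e]; the [1] keeps [C] positive. *)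
set C := 1 + 2 * ssq mu D h + 2 * ssq mu D k.
have C0 : 0 < C by rewrite /C; have := ssq_ge0 mu D h; have := ssq_ge0 mu D k; lra.
have [f' [g' [sf' sg' ef eg E]]] := H (e / C) (divr_gt0 e0 C0).
have := cauchy_schwarz mD (sqintB mD sf' sf) sh.
have := cauchy_schwarz mD (sqintB mD sg' sg) sk.
have lin u w z : sqint mu D u -> sqint mu D w -> sqint mu D z ->
    ip mu D (fun x => u x - w x) z = ip mu D u z - ip mu D w z.
  move=> su sw sz; have := ip_linl mD 1 (-1) su sw sz.
  rewrite mul1r mulN1r => <-; apply: eq_Rintegral => x _.
  by rewrite mul1r mulN1r.
rewrite !lin// E.
set A := ip mu D f h; set B := ip mu D g k; set B' := ip mu D g' k.
move=> H1 H2.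
have h0 := ssq_ge0 mu D h; have k0 := ssq_ge0 mu D k.
have {}H1 : (B' - B) ^+ 2 <= e / C * ssq mu D k.
  by apply: le_trans H1 _; rewrite ler_wpM2r.
have {}H2 : (- B' - A) ^+ 2 <= e / C * ssq mu D h.
  by apply: le_trans H2 _; rewrite ler_wpM2r.
have : (A + B) ^+ 2 <= 2 * (B' - B) ^+ 2 + 2 * (- B' - A) ^+ 2.
  have := sqr_ge0 ((B' - B) - (- B' - A)); nra.
have : e / C * C = e by rewrite divfK// gt_eqF.
have eC0 : 0 < e / C by rewrite divr_gt0.
rewrite {2}/C; nra.
Qed.

End ssq_extra.

(** * Measure-preserving maps and the reflection of the box *)

Section measure_preserving.
Context d (T : measurableType d) (R : realType)
  (mu : {measure set T -> \bar R}) (h : T -> T) (D : set T).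
Hypotheses (mD : measurable D) (mh : measurable_fun setT h)
  (muh : forall A, measurable A -> mu (h @^-1` A) = mu A) (hD : h @^-1` D = D).
Implicit Types g : T -> R.

Let measurable_preimage A : measurable A -> measurable (h @^-1` A).
Proof. by move=> mA; rewrite -[X in measurable X]setTI; exact: mh. Qed.

Lemma measurable_fun_preserving {d'} {U : measurableType d'} (f : T -> U) :
  measurable_fun D f -> measurable_fun D (f \o h).
Proof.
move=> mf _ Y mY; rewrite comp_preimage -{1}hD -preimage_setI.
exact/measurable_preimage/mf.
Qed.

Lemma ge0_integral_preserving (f : T -> \bar R) : measurable_fun D f ->
  (forall x, D x -> 0 <= f x)%E ->
  (\int[mu]_(x in D) f (h x) = \int[mu]_(x in D) f x)%E.
Proof.
move=> mf f0; rewrite -{1}hD.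
rewrite -(ge0_integral_pushforward mh mu mD mf); last first.
  by move=> x /set_mem; exact: f0.
by apply: eq_measure_integral => A mA _; exact: muh.
Qed.

Lemma integrable_preserving g : mu.-integrable D (EFin \o g) ->
  mu.-integrable D (EFin \o (g \o h)).
Proof.
move=> /integrableP[mg ig]; apply/integrableP; split.
  exact: (measurable_fun_preserving mg).
rewrite (ge0_integral_preserving (f := fun x => `|(g x)%:E|%E))//.
exact: measurableT_comp.
Qed.

Lemma Rintegral_preserving g : mu.-integrable D (EFin \o g) ->
  \int[mu]_(x in D) g (h x) = \int[mu]_(x in D) g x.
Proof.
move=> ig; have [mg _] := integrableP _ _ _ ig; congr fine.
rewrite [LHS]integralE [RHS]integralE; congr (_ - _)%E.
- rewrite -[RHS]ge0_integral_preserving//; last exact: measurable_funepos.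
  by apply: eq_integral => x _; rewrite !funeposE.
- rewrite -[RHS]ge0_integral_preserving//; last exact: measurable_funeneg.
  by apply: eq_integral => x _; rewrite !funenegE.
Qed.

Lemma sqint_preserving g : sqint mu D g -> sqint mu D (g \o h).
Proof.
move=> [mg ig]; split; first exact: measurable_fun_preserving.
exact: (integrable_preserving ig).
Qed.

Lemma ssq_preserving g : sqint mu D g -> ssq mu D (g \o h) = ssq mu D g.
Proof. by move=> [mg ig]; exact: (Rintegral_preserving ig). Qed.

Lemma ae_preserving (P : T -> Prop) : {ae mu, forall x, P x} ->
  {ae mu, forall x, P (h x)}.
Proof.
move=> [N [mN N0 NP]]; exists (h @^-1` N); split.
- exact: measurable_preimage.
- by rewrite muh.
- by move=> x /= nP; apply: NP.
Qed.

End measure_preserving.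

Section reflection.
Context {R : realType} (L T : R).
Local Notation Om := (Omega L T).
Local Notation R2 := (measurableTypeR R * measurableTypeR R)%type.

Lemma measurable_refl : measurable_fun setT (refl : R2 -> R2).
Proof.
apply: measurable_fun_pair; last exact: measurable_snd.
apply: (@measurableT_comp _ _ _ _ _ _ (fun x : measurableTypeR R => - x : measurableTypeR R)).
  exact: oppr_measurable.
exact: measurable_fst.
Qed.

Lemma preimage_refl_Omega : refl @^-1` Om = Om.
Proof.
apply/seteqP; split => [[x z]|[x z]] /OmegaP[/= /andP[? ?] ?]; apply/OmegaP;
  split => //=; apply/andP; split; lra.
Qed.

(** By uniqueness of the product measure only rectangles have to be checked, and there it is the
    symmetry of the Lebesgue measure on the line. *)
Lemma leb2_refl (A : set R2) : measurable A ->
  leb2 (refl @^-1` A) = leb2 A.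
Proof.
move=> mA; apply/esym.
have := @product_measure_unique _ _ _ _ R (@lebesgue_measure R) (@lebesgue_measure R)
  (pushforward leb2 (refl : R2 -> R2)).
move=> /(_ measurable_refl) H; apply: H mA => B C mB mC; transitivity (leb2 ((-%R @^-1` B : set (measurableTypeR R)) `*` C)); first by [].
rewrite /leb2/= product_measure1E//.
  by rewrite -(lebesgue_measureN mB).
by rewrite -[X in measurable X]setTI; exact: oppr_measurable.
Qed.

End reflection.

(** * Traces and weak derivatives *)

Section sobolev.
Context {R : realType} (L T : R).
Hypotheses (L0 : 0 < L) (T0 : 0 < T).
Local Notation Om := (Omega L T).
Local Notation R2 := (measurableTypeR R * measurableTypeR R)%type.
Local Notation I := (`]- (L / 2), L / 2[%classic : set (measurableTypeR R)).
Local Notation J := (`]0, T[%classic : set (measurableTypeR R)).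
Local Notation sq := (sqint leb2 Om).
Local Notation nsq := (ssq leb2 Om).
Implicit Types (f g phi : R * R -> R) (e : R * R).

Let mOm : measurable (Om : set R2). Proof. exact: measurable_Omega. Qed.

Definition axis e := e = ex \/ e = ez.

Lemma smooth_derivable f e p : axis e -> smooth f -> derivable f p e.
Proof.
by move=> eE /(_ 1%N) [_ [dx dz _ _]]; case: eE => ->; [exact: dx|exact: dz].
Qed.

Lemma smooth_D_continuous f e : axis e -> smooth f -> continuous ('D_e f).
Proof.
by move=> eE /(_ 1%N) [_ [_ _ [cx _] [cz _]]]; case: eE => ->; [exact: cx|exact: cz].
Qed.

Lemma smooth_sqint f : smooth f -> sq f.
Proof. by move=> sf; apply: continuous_sqint; exact: (Ck_continuous (sf 0%N)). Qed.

Lemma smooth_D_sqint f e : axis e -> smooth f -> sq ('D_e f).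
Proof. by move=> eE sf; apply: continuous_sqint; exact: smooth_D_continuous. Qed.

Lemma test_smooth phi : test_fun Om phi -> smooth phi.
Proof. by case. Qed.

Lemma weak_derive_lin a b e f f' g g' : axis e -> sq f -> sq g ->
  weak_derive Om e f f' -> weak_derive Om e g g' ->
  weak_derive Om e (fun p => a * f p + b * g p) (fun p => a * f' p + b * g' p).
Proof.
move=> eE sf sg [sf' Hf] [sg' Hg]; split; first exact: (sqint_lin mOm).
move=> phi tphi; have sphi := test_smooth tphi.
have s1 := smooth_sqint sphi; have s2 := smooth_D_sqint eE sphi.
have := ip_linl mOm a b sf sg s2; have := ip_linl mOm a b sf' sg' s1.
rewrite /ip => -> ->; rewrite Hf// Hg//; ring.
Qed.

Lemma weak_derive_lim e f f' : axis e -> sq f -> sq f' ->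
  (forall d : R, 0 < d -> exists g g', [/\ sq g, weak_derive Om e g g',
    nsq (fun p => g p - f p) <= d & nsq (fun p => g' p - f' p) <= d]) ->
  weak_derive Om e f f'.
Proof.
move=> eE sf sf' H; split => // phi tphi; have sphi := test_smooth tphi.
have s1 := smooth_sqint sphi; have s2 := smooth_D_sqint eE sphi.
apply: (ip_eq_of_approx mOm sf sf' s2 s1) => d /H[g [g' [sg [sg' Hg] gf gf']]].
by exists g, g'; split => //; exact: Hg.
Qed.

Lemma wD_spec e f : (exists g, weak_derive Om e f g) ->
  weak_derive Om e f (wD Om e f).
Proof. by move=> [g Hg]; exact: (@xgetPex _ (fun=> 0) [set g | weak_derive Om e f g] (ex_intro _ g Hg)). Qed.

Lemma wD_unique e f g : weak_derive Om e f g ->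
  {ae leb2, forall p, Om p -> wD Om e f p = g p}.
Proof.
move=> Hg; apply: (weak_derive_unique L0 T0) (Hg); apply: wD_spec.
by exists g.
Qed.

(* [approx S gam f fx fz]: the trace of [f] on the side parametrised by [gam]
   vanishes, and [(fx, fz)] is the gradient of [f]. *)
Definition approx (S : set R) (gam : R -> R * R) f fx fz := forall d : R, 0 < d ->
  exists phi, [/\ smooth phi, nsq (fun p => phi p - f p) <= d,
    nsq (fun p => 'D_ex phi p - fx p) <= d,
    nsq (fun p => 'D_ez phi p - fz p) <= d &
    ssq leb1 S (phi \o gam) <= d].

(** The sequence is recovered by choosing a smooth function at accuracy [1/(n+1)]. The epsilon form
    spares diagonal sequences when limits are taken. *)
Lemma is_trace_approx a b gam f : continuous gam ->
  sq f -> sq (wD Om ex f) -> sq (wD Om ez f) ->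
  is_trace Om `]a, b[ gam f (fun=> 0) <->
  approx `]a, b[ gam f (wD Om ex f) (wD Om ez f).
Proof.
move=> cgam sf sfx sfz.
have sgam phi : smooth phi -> sqint leb1 `]a, b[%classic (phi \o gam).
  move=> sphi; apply: continuous_sqint1 => s; apply: continuous_comp.
    exact: cgam.
  exact: (Ck_continuous (sphi 0%N)).
have mab : measurable (`]a, b[%classic : set (measurableTypeR R)).
  exact: measurable_itv.
have axx : axis ex by left.
have axz : axis ez by right.
have s1 phi : smooth phi -> sq (fun p => phi p - f p).
  by move=> sphi; apply: (sqintB mOm) => //; exact: smooth_sqint.
have s2 phi : smooth phi -> sq (fun p => 'D_ex phi p - wD Om ex f p).
  by move=> sphi; apply: (sqintB mOm) => //; exact: smooth_D_sqint.
have s3 phi : smooth phi -> sq (fun p => 'D_ez phi p - wD Om ez f p).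
  by move=> sphi; apply: (sqintB mOm) => //; exact: smooth_D_sqint.
have E0 (phi : nat -> R * R -> R) : (fun n => \int[leb1]_(s in `]a, b[)
     ((phi n (gam s) - (fun=> 0) s) ^+ 2)%:E)%E =
   (fun n => \int[leb1]_(s in `]a, b[) (((phi n \o gam) s) ^+ 2)%:E)%E.
  apply/funext => n; apply: eq_integral => s _; by rewrite subr0.
split.
- move=> [phi [sphi [c1 c2 c3]]]; rewrite E0 => c4 d d0.
  have {}c1 := (cvg_ssq0 mOm (fun n => s1 _ (sphi n))).1 c1 d d0.
  have {}c2 := (cvg_ssq0 mOm (fun n => s2 _ (sphi n))).1 c2 d d0.
  have {}c3 := (cvg_ssq0 mOm (fun n => s3 _ (sphi n))).1 c3 d d0.
  have {}c4 := (cvg_ssq0 mab (fun n => sgam _ (sphi n))).1 c4 d d0.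
  have [n _] := filterI (filterI c1 c2) (filterI c3 c4).
  move=> /(_ n (leqnn n)) [[b1 b2] [b3 b4]].
  exists (phi n); exact: (And5 (sphi n) b1 b2 b3 b4).
- move=> H.
  have /choice[phi Hphi] : forall n : nat, exists phi, [/\ smooth phi,
      nsq (fun p => phi p - f p) <= n.+1%:R^-1,
      nsq (fun p => 'D_ex phi p - wD Om ex f p) <= n.+1%:R^-1,
      nsq (fun p => 'D_ez phi p - wD Om ez f p) <= n.+1%:R^-1 &
      ssq leb1 `]a, b[ (phi \o gam) <= n.+1%:R^-1].
    by move=> n; apply: H; rewrite invr_gt0.
  have sphi n : smooth (phi n) by have [] := Hphi n.
  have small (u : nat -> R) : (forall n, u n <= n.+1%:R^-1) ->
      forall d : R, 0 < d -> \forall n \near \oo, u n <= d.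
    move=> un d d0; have := near_infty_natSinv_lt (PosNum d0).
    by apply: filterS => n /ltW; exact: le_trans.
  exists phi; split; [exact: sphi| |].
    split.
    + apply/(cvg_ssq0 mOm (fun n => s1 _ (sphi n))).
      by apply: small => n; have [] := Hphi n.
    + apply/(cvg_ssq0 mOm (fun n => s2 _ (sphi n))).
      by apply: small => n; have [] := Hphi n.
    + apply/(cvg_ssq0 mOm (fun n => s3 _ (sphi n))).
      by apply: small => n; have [] := Hphi n.
  rewrite E0; apply/(cvg_ssq0 mab (fun n => sgam _ (sphi n))).
  by apply: small => n; have [] := Hphi n.
Qed.

End sobolev.

(** * Functions vanishing on three sides: linearity, limits, reflection, Poincare inequality *)

Section sobolev_zero_sides.
Context {R : realType} (L T : R).
Hypotheses (L0 : 0 < L) (T0 : 0 < T).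
Local Notation Om := (Omega L T).
Local Notation R2 := (measurableTypeR R * measurableTypeR R)%type.
Local Notation sq := (sqint leb2 Om).
Local Notation nsq := (ssq leb2 Om).
Implicit Types (f g phi : R * R -> R) (e : R * R) (gam : R -> R * R).

Let mOm : measurable (Om : set R2). Proof. exact: measurable_Omega. Qed.
Let axx : @axis R ex. Proof. by left. Qed.
Let axz : @axis R ez. Proof. by right. Qed.

Section side.
Variables (a b : R) (gam : R -> R * R).
Local Notation S := (`]a, b[%classic : set (measurableTypeR R)).
Hypothesis cgam : continuous gam.

Let mS : measurable S. Proof. exact: measurable_itv. Qed.

Lemma smooth_sqint_side phi : smooth phi -> sqint leb1 S (phi \o gam).
Proof.
move=> sphi; apply: continuous_sqint1 => s; apply: continuous_comp.
  exact: cgam.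
exact: (Ck_continuous (sphi 0%N)).
Qed.

Lemma approx_lin (c k : R) f fx fz g gx gz : sq f -> sq fx -> sq fz ->
  sq g -> sq gx -> sq gz ->
  approx L T S gam f fx fz -> approx L T S gam g gx gz ->
  approx L T S gam (fun p => c * f p + k * g p)
    (fun p => c * fx p + k * gx p) (fun p => c * fz p + k * gz p).
Proof.
move=> sf sfx sfz sg sgx sgz Hf Hg d d0.
(* The coefficients come from [ssq_lin_le]; the added [1] makes [C] positive even if [c] and [k]
   vanish. *)
pose C := 2 * c ^+ 2 + 2 * k ^+ 2 + 1.
have C0 : 0 < C by rewrite /C; have := sqr_ge0 c; have := sqr_ge0 k; lra.
have bnd (x y : R) : x <= d / C -> y <= d / C ->
    2 * c ^+ 2 * x + 2 * k ^+ 2 * y <= d.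
  move=> xd yd; have dC : d / C * C = d by rewrite divfK// gt_eqF.
  have dC0 : 0 < d / C by rewrite divr_gt0.
  rewrite -dC /C; have := sqr_ge0 c; have := sqr_ge0 k => c0 k0.
  have := ler_wpM2l c0 yd; have := ler_wpM2l k0 xd; nra.
have [phi [sphi p1 p2 p3 p4]] := Hf _ (divr_gt0 d0 C0).
have [psi [spsi q1 q2 q3 q4]] := Hg _ (divr_gt0 d0 C0).
have key (u v u' v' : R * R -> R) : sq u -> sq v -> sq u' -> sq v' ->
    nsq (fun p => u p - u' p) <= d / C -> nsq (fun p => v p - v' p) <= d / C ->
    nsq (fun p => (c * u p + k * v p) - (c * u' p + k * v' p)) <= d.
  move=> su sv su' sv' H1 H2; apply: le_trans (bnd _ _ H1 H2).
  apply: le_trans (ssq_lin_le mOm c k (sqintB mOm su su') (sqintB mOm sv sv')).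
  rewrite le_eqVlt; apply/orP; left; apply/eqP; apply: eq_ssq => p _; ring.
have D e p : axis e -> 'D_e (fun p => c * phi p + k * psi p) p =
    c * 'D_e phi p + k * 'D_e psi p.
  move=> ae; have := is_derive_lin c k
    (derivableP (@smooth_derivable _ phi e p ae sphi)) (derivableP (@smooth_derivable _ psi e p ae spsi)).
  by move=> H; rewrite (@derive_val _ _ _ _ _ _ _ H).
exists (fun p => c * phi p + k * psi p); split.
- exact: smooth_lin.
- by apply: key => //; exact: smooth_sqint.
- rewrite (eq_ssq leb2 (g := fun p =>
    (c * 'D_ex phi p + k * 'D_ex psi p) - (c * fx p + k * gx p))).
    by apply: key => //; exact: smooth_D_sqint.
  by move=> p _; rewrite D.
- rewrite (eq_ssq leb2 (g := fun p =>
    (c * 'D_ez phi p + k * 'D_ez psi p) - (c * fz p + k * gz p))).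
    by apply: key => //; exact: smooth_D_sqint.
  by move=> p _; rewrite D.
- apply: le_trans (bnd _ _ p4 q4).
  exact: (ssq_lin_le mS c k (smooth_sqint_side sphi) (smooth_sqint_side spsi)).
Qed.

Lemma approx_lim f fx fz : sq f -> sq fx -> sq fz ->
  (forall d : R, 0 < d -> exists g gx gz,
    [/\ [/\ sq g, sq gx & sq gz], approx L T S gam g gx gz,
      nsq (fun p => g p - f p) <= d,
      nsq (fun p => gx p - fx p) <= d & nsq (fun p => gz p - fz p) <= d]) ->
  approx L T S gam f fx fz.
Proof.
(* [ssqB_le] doubles both errors, so two quarters of [d] add up to [d]. *)
move=> sf sfx sfz H d d0; have d4 : 0 < d / 4 by rewrite divr_gt0.
have [g [gx [gz [[sg sgx sgz] /(_ _ d4)[phi [sphi p1 p2 p3 p4]] h1 h2 h3]]]] := H _ d4.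
have key (u v w : R * R -> R) : sq u -> sq v -> sq w ->
    nsq (fun p => u p - v p) <= d / 4 -> nsq (fun p => v p - w p) <= d / 4 ->
    nsq (fun p => u p - w p) <= d.
  by move=> su sv sw H1 H2; apply: le_trans (ssqB_le mOm su sv sw) _; lra.
exists phi; split.
- exact: sphi.
- exact: (key phi g f (smooth_sqint _ _ sphi)).
- exact: (key ('D_ex phi) gx fx (smooth_D_sqint _ _ axx sphi)).
- exact: (key ('D_ez phi) gz fz (smooth_D_sqint _ _ axz sphi)).
- by apply: le_trans p4 _; lra.
Qed.

Lemma approx_ae f fx fz gx gz : sq fx -> sq fz -> sq gx -> sq gz ->
  {ae leb2, forall p, Om p -> fx p = gx p} ->
  {ae leb2, forall p, Om p -> fz p = gz p} ->
  approx L T S gam f fx fz -> approx L T S gam f gx gz.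
Proof.
move=> sfx sfz sgx sgz Ex Ez H d /H[phi [sphi p1 p2 p3 p4]].
have key (u v w : R * R -> R) : sq u -> sq v -> sq w ->
    {ae leb2, forall p, Om p -> v p = w p} ->
    nsq (fun p => u p - v p) <= d -> nsq (fun p => u p - w p) <= d.
  move=> su sv sw E; rewrite (@ae_eq_ssq _ _ _ leb2 _ mOm _ (fun p => u p - w p))//.
  - by have [] := sqintB mOm su sv.
  - by have [] := sqintB mOm su sw.
  - by apply: (ae2_imply E) => p /[apply] ->.
exists phi; split.
- exact: sphi.
- exact: p1.
- exact: (key ('D_ex phi) fx gx (smooth_D_sqint _ _ axx sphi)).
- exact: (key ('D_ez phi) fz gz (smooth_D_sqint _ _ axz sphi)).
- exact: p4.
Qed.

Lemma approx_smooth f : smooth f -> (forall s, S s -> f (gam s) = 0) ->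
  approx L T S gam f ('D_ex f) ('D_ez f).
Proof.
move=> sf f0 d d0.
have z d' (U : measurableType d') (m : {measure set U -> \bar R}) (A : set U) (u : U -> R) :
    (forall x, A x -> u x = 0) -> ssq m A u <= d.
  by move=> u0; rewrite /ssq Rintegral0_eq ?ltW// => x /u0 ->; rewrite expr0n.
by exists f; split; [exact: sf|apply: z => p _; rewrite subrr..|apply: z].
Qed.

End side.

Lemma refl_derive phi e (c : R) p : smooth phi -> axis e -> e = ex /\ c = -1 \/ e = ez /\ c = 1 ->
  'D_e (phi \o refl) p = c * 'D_e phi (refl p).
Proof.
move=> sphi ae ec; have := derivableP (@smooth_derivable _ phi e (refl p) ae sphi) => H.
have : is_derive p e (phi \o refl) (c * 'D_e phi (refl p)).
  apply: (is_derive_comp_affine _ H) => t.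
  by case: ec => -[-> ->]; apply/pair_equal_spec; rewrite /refl/= /GRing.scale/=;
    split; ring.
by move=> H'; rewrite (@derive_val _ _ _ _ _ _ _ H').
Qed.

Let prefl := @preimage_refl_Omega R L T.
Let mrefl := @measurable_refl R.
Let lrefl := @leb2_refl R.

Lemma sq_refl f : sq f -> sq (f \o refl).
Proof. exact: (sqint_preserving mOm mrefl lrefl prefl). Qed.

Lemma nsq_refl f : sq f -> nsq (f \o refl) = nsq f.
Proof. exact: (ssq_preserving mOm mrefl lrefl prefl). Qed.

(** The hypothesis on [phi] says that [refl \o gam'] runs over the side of [gam] up to a change of
    parameter preserving norms: the two lateral sides are exchanged, and the top is traversed
    backwards. *)
Lemma approx_refl (a b : R) gam gam' f fx fz : sq f -> sq fx -> sq fz ->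
  continuous gam ->
  (forall phi, smooth phi -> ssq leb1 `]a, b[ (phi \o (refl \o gam')) =
                             ssq leb1 `]a, b[ (phi \o gam)) ->
  approx L T `]a, b[ gam f fx fz ->
  approx L T `]a, b[ gam' (f \o refl) (fun p => - fx (refl p)) (fz \o refl).
Proof.
move=> sf sfx sfz cgam Hs H d /H[phi [sphi p1 p2 p3 p4]].
exists (phi \o refl); split.
- exact: smooth_refl.
- by rewrite -(nsq_refl (sqintB mOm (smooth_sqint _ _ sphi) sf)) in p1.
- have sD := sqintB mOm (smooth_D_sqint _ _ axx sphi) sfx.
  rewrite -(nsq_refl sD) in p2; apply: le_trans p2; rewrite le_eqVlt.
  apply/orP; left; apply/eqP; apply: eq_Rintegral => p _.
  by rewrite (@refl_derive _ _ (-1))//=; [ring|left].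
- have sD := sqintB mOm (smooth_D_sqint _ _ axz sphi) sfz.
  rewrite -(nsq_refl sD) in p3; apply: le_trans p3; rewrite le_eqVlt.
  apply/orP; left; apply/eqP; apply: eq_Rintegral => p _.
  by rewrite (@refl_derive _ _ 1)//=; [rewrite mul1r|right].
- by rewrite Hs.
Qed.

(** Tests the identity for [f] against [phi \o refl] and changes variables. The sign [c] is that of
    the reflection along the axis [e], and [c * c = 1]. *)
Lemma weak_derive_refl f g e (c : R) : sq f -> axis e ->
  e = ex /\ c = -1 \/ e = ez /\ c = 1 ->
  weak_derive Om e f g -> weak_derive Om e (f \o refl) (fun p => c * g (refl p)).
Proof.
move=> sf ae ec [sg H]; split.
  exact: (sqintZ mOm c (sq_refl sg)).
move=> phi tphi; have sphi := test_smooth tphi.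
have tphi' : test_fun Om (phi \o refl).
  have [_ cphi iphi] := tphi.
  have crefl : continuous (@refl R) by exact: refl_continuous.
  (* The support of [phi \o refl] lies in the reflected support of [phi], which is compact and
     inside the symmetric box. *)
  have E : closure [set p | (phi \o refl) p != 0] `<=`
      refl @` closure [set p | phi p != 0].
    move=> p Hp; exists (refl p); last by rewrite reflK.
    move=> B /crefl nB; have [q [q0 qB]] := Hp _ nB.
    by exists (refl q).
  have cK : compact (refl @` closure [set p | phi p != 0]).
    by apply: continuous_compact => //; exact: continuous_subspaceT.
  split.
  - exact: smooth_refl.
  - by apply: subclosed_compact cK E; exact: closed_closure.
  - move=> p /E[q /iphi qO <-]; have : (refl @^-1` Om) q by rewrite prefl.
    by [].
have cc : c * c = 1 by case: ec => -[_ ->]; ring.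
have := H _ tphi'.
have If : leb2.-integrable Om (EFin \o (fun p => f p * 'D_e (phi \o refl) p)).
  by apply: (sqint_mul mOm sf); apply: smooth_D_sqint => //; exact: smooth_refl.
have Ig : leb2.-integrable Om (EFin \o (fun p => g p * (phi \o refl) p)).
  by apply: (sqint_mul mOm sg); apply: smooth_sqint; exact: smooth_refl.
rewrite -(Rintegral_preserving mOm mrefl lrefl prefl If).
rewrite -(Rintegral_preserving mOm mrefl lrefl prefl Ig) => HH.
have -> : \int[leb2]_(p in Om) ((f \o refl) p * 'D_e phi p) =
    c * \int[leb2]_(p in Om) (f (refl p) * 'D_e (phi \o refl) (refl p)).
  rewrite -RintegralZl//; last exact: (integrable_preserving mOm mrefl lrefl prefl If).
  apply: eq_Rintegral => p _; rewrite (refl_derive _ sphi ae ec) reflK/=.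
  by rewrite [RHS]mulrCA [c * (c * _)]mulrA cc mul1r.
rewrite HH mulrN; congr (- _).
rewrite -RintegralZl//; last exact: (integrable_preserving mOm mrefl lrefl prefl Ig).
by apply: eq_Rintegral => p _ /=; rewrite reflK mulrA.
Qed.

Definition sideL (z : R) : R * R := (- (L / 2), z).
Definition sideR (z : R) : R * R := (L / 2, z).
Definition sideT (x : R) : R * R := (x, T).

Let csL : continuous sideL.
Proof.
move=> z; apply: (@cvg_pair _ _ _ _ (nbhs (- (L / 2))) (nbhs z)).
  exact: cvg_cst.
exact: cvg_id.
Qed.
Let csR : continuous sideR.
Proof.
move=> z; apply: (@cvg_pair _ _ _ _ (nbhs (L / 2)) (nbhs z)).
  exact: cvg_cst.
exact: cvg_id.
Qed.
Let csT : continuous sideT.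
Proof.
move=> x; apply: (@cvg_pair _ _ _ _ (nbhs x) (nbhs T)).
  exact: cvg_id.
exact: cvg_cst.
Qed.

(* [Hd f fx fz]: [f] belongs to the space [H] and has gradient [(fx, fz)]. Unlike
   the representatives chosen by [wD], a gradient given as a parameter follows
   linear combinations, limits and reflections of [f] on the nose. *)
Definition Hd f fx fz : Prop :=
  [/\ [/\ sq f, weak_derive Om ex f fx & weak_derive Om ez f fz],
      approx L T `]0, T[ sideL f fx fz, approx L T `]0, T[ sideR f fx fz &
      approx L T `]- (L / 2), L / 2[ sideT f fx fz].

Lemma Hd_sq f fx fz : Hd f fx fz -> [/\ sq f, sq fx & sq fz].
Proof. by move=> [[sf [sfx _] [sfz _]] _ _ _]. Qed.

Lemma Hd_of_H f : H L T f -> Hd f (wD Om ex f) (wD Om ez f).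
Proof.
move=> [[sf Ex Ez] tL tR tT]; have Wx := wD_spec Ex; have Wz := wD_spec Ez.
have [sx _] := Wx; have [sz _] := Wz; split.
- by split.
- exact: (proj1 (is_trace_approx _ _ csL sf sx sz) tL).
- exact: (proj1 (is_trace_approx _ _ csR sf sx sz) tR).
- exact: (proj1 (is_trace_approx _ _ csT sf sx sz) tT).
Qed.

Lemma Hd_wD f fx fz : Hd f fx fz ->
  {ae leb2, forall p, Om p -> wD Om ex f p = fx p} /\
  {ae leb2, forall p, Om p -> wD Om ez f p = fz p}.
Proof. by move=> [[_ Wx Wz] _ _ _]; split; exact: wD_unique. Qed.

(** The given gradient agrees with the one chosen by [wD] almost everywhere, and [approx] does not
    see null sets. *)
Lemma H_of_Hd f fx fz : Hd f fx fz -> H L T f.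
Proof.
move=> Hf; have [sf sfx sfz] := Hd_sq Hf; have [Ex Ez] := Hd_wD Hf.
have [[_ Wx Wz] aL aR aT] := Hf.
have [sx _] := wD_spec (ex_intro _ _ Wx); have [sz _] := wD_spec (ex_intro _ _ Wz).
have sym (u v : R * R -> R) : {ae leb2, forall p, Om p -> u p = v p} ->
    {ae leb2, forall p, Om p -> v p = u p}.
  by move=> uv; apply: (ae2_imply uv) => p /[apply].
split.
- by split; [exact: sf|exists fx|exists fz].
- apply: (proj2 (is_trace_approx _ _ csL sf sx sz)).
  exact: (approx_ae sfx sfz sx sz (sym _ _ Ex) (sym _ _ Ez)).
- apply: (proj2 (is_trace_approx _ _ csR sf sx sz)).
  exact: (approx_ae sfx sfz sx sz (sym _ _ Ex) (sym _ _ Ez)).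
- apply: (proj2 (is_trace_approx _ _ csT sf sx sz)).
  exact: (approx_ae sfx sfz sx sz (sym _ _ Ex) (sym _ _ Ez)).
Qed.

Lemma Hd_lin (c k : R) f fx fz g gx gz : Hd f fx fz -> Hd g gx gz ->
  Hd (fun p => c * f p + k * g p) (fun p => c * fx p + k * gx p)
     (fun p => c * fz p + k * gz p).
Proof.
move=> Hf Hg; have [sf sfx sfz] := Hd_sq Hf; have [sg sgx sgz] := Hd_sq Hg.
have [[_ Wx Wz] aL aR aT] := Hf; have [[_ Wx' Wz'] aL' aR' aT'] := Hg.
split.
- split; first exact: (sqint_lin mOm).
  + exact: (weak_derive_lin c k axx sf sg Wx Wx').
  + exact: (weak_derive_lin c k axz sf sg Wz Wz').
- exact: approx_lin.
- exact: approx_lin.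
- exact: approx_lin.
Qed.

Lemma Hd_lim f fx fz : sq f -> sq fx -> sq fz ->
  (forall d : R, 0 < d -> exists g gx gz, [/\ Hd g gx gz,
    nsq (fun p => g p - f p) <= d,
    nsq (fun p => gx p - fx p) <= d & nsq (fun p => gz p - fz p) <= d]) ->
  Hd f fx fz.
Proof.
move=> sf sfx sfz HH; split.
- split; first exact: sf.
  + apply: (weak_derive_lim axx sf sfx) => d /HH[g [gx [gz [Hg h1 h2 _]]]].
    exists g, gx; have [[sg Wx _] _ _ _] := Hg; exact: (And4 sg Wx h1 h2).
  + apply: (weak_derive_lim axz sf sfz) => d /HH[g [gx [gz [Hg h1 _ h3]]]].
    exists g, gz; have [[sg _ Wz] _ _ _] := Hg; exact: (And4 sg Wz h1 h3).
- apply: (approx_lim sf sfx sfz) => d /HH[g [gx [gz [Hg h1 h2 h3]]]].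
  exists g, gx, gz; have [sg sgx sgz] := Hd_sq Hg; have [_ a _ _] := Hg.
  exact: (And5 (And3 sg sgx sgz) a h1 h2 h3).
- apply: (approx_lim sf sfx sfz) => d /HH[g [gx [gz [Hg h1 h2 h3]]]].
  exists g, gx, gz; have [sg sgx sgz] := Hd_sq Hg; have [_ _ a _] := Hg.
  exact: (And5 (And3 sg sgx sgz) a h1 h2 h3).
- apply: (approx_lim sf sfx sfz) => d /HH[g [gx [gz [Hg h1 h2 h3]]]].
  exists g, gx, gz; have [sg sgx sgz] := Hd_sq Hg; have [_ _ _ a] := Hg.
  exact: (And5 (And3 sg sgx sgz) a h1 h2 h3).
Qed.

Lemma Hd_refl f fx fz : Hd f fx fz ->
  Hd (f \o refl) (fun p => - fx (refl p)) (fz \o refl).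
Proof.
move=> Hf; have [sf sfx sfz] := Hd_sq Hf; have [[_ Wx Wz] aL aR aT] := Hf.
split.
- split; first exact: sq_refl.
  + have [|sr Hr] := @weak_derive_refl f fx ex (-1) sf axx _ Wx; first by left.
    split; first by move: sr; congr sqint; apply/funext => p; rewrite mulN1r.
    move=> phi /Hr ->; congr (- _); apply: eq_Rintegral => p _.
    by rewrite mulN1r.
  + have [|sr Hr] := @weak_derive_refl f fz ez 1 sf axz _ Wz; first by right.
    split; first by move: sr; congr sqint; apply/funext => p; rewrite mul1r.
    move=> phi /Hr ->; congr (- _); apply: eq_Rintegral => p _.
    by rewrite mul1r.
(* The left trace of the reflected function comes from the right trace of [f], and conversely
   below. *)
- apply: (approx_refl sf sfx sfz csR _ aR) => phi _; apply: eq_ssq => z _.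
  by rewrite /refl/= opprK.
- by apply: (approx_refl sf sfx sfz csL _ aL) => phi _; exact: eq_ssq.
- apply: (approx_refl sf sfx sfz csT _ aT) => phi sphi.
  pose I : set (measurableTypeR R) := `]- (L / 2), L / 2[%classic.
  have mI : measurable I by exact: measurable_itv.
  have mN : measurable_fun setT (-%R : measurableTypeR R -> measurableTypeR R).
    exact: oppr_measurable.
  have lN (A : set (measurableTypeR R)) : measurable A -> leb1 (-%R @^-1` A) = leb1 A.
    by move=> mA; rewrite -[RHS]/(lebesgue_measure A) -lebesgue_measureN.
  have pN : -%R @^-1` I = I.
    by apply/seteqP; split => x; rewrite /I/= !in_itv/= => /andP[? ?];
      apply/andP; split; lra.
  by rewrite -(ssq_preserving mI mN lN pN (smooth_sqint_side _ _ csT sphi)).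
Qed.

Lemma poincare f fx fz : Hd f fx fz -> nsq f <= 16 * L ^+ 2 * nsq fx.
Proof.
move=> Hf; have [sf sfx sfz] := Hd_sq Hf; have [_ aL _ _] := Hf.
apply/ler_addgt0Pl => e e0.
(* Passing from [f] to [phi] and from the derivative of [phi] to [fx] doubles twice, so the [4 L^2]
   of [poincare_smooth] becomes [16 L^2]; [C] collects the error terms [2], [2 * 2 L] and
   [2 * 4 L^2 * 2]. *)
pose C := 2 + 4 * L + 16 * L ^+ 2.
have L2 : 0 < L ^+ 2 by rewrite exprn_gt0.
have C0 : 0 < C by rewrite /C !addr_gt0// mulr_gt0.
have [phi [sphi p1 p2 _ p4]] := aL _ (divr_gt0 e0 C0).
have sp := smooth_sqint L T sphi; have sD := smooth_D_sqint L T axx sphi.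
have h1 : nsq f <= 2 * nsq (fun p => phi p - f p) + 2 * nsq phi.
  rewrite (ssqBC leb2 Om phi f).
  have := ssqD_le mOm (sqintB mOm sf sp) sp.
  by rewrite (@eq_ssq _ _ _ leb2 Om (fun x => f x - phi x + phi x) f)// => p _; rewrite subrK.
have h2 := poincare_smooth T L0 sphi.
have h3 : nsq ('D_ex phi) <= 2 * nsq (fun p => 'D_ex phi p - fx p) + 2 * nsq fx.
  have := ssqD_le mOm (sqintB mOm sD sfx) sfx.
  rewrite (@eq_ssq _ _ _ leb2 Om (fun x => 'D_ex phi x - fx x + fx x) ('D_ex phi)).
    by [].
  by move=> p _; rewrite subrK.
have eC : e / C * C = e by rewrite divfK// gt_eqF.
rewrite -eC {2}/C; set d := e / C in p1 p2 p4 *.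
move: h1 h2 h3 p1 p2 p4.
set A := nsq _; set B := nsq _; set D := nsq _; set E := ssq _ _ _.
set F := nsq _; set G := nsq _; set K := nsq _.
move=> h1 h2 h3 p1 p2 p4.
have : L ^+ 2 * F <= L ^+ 2 * (2 * d + 2 * K).
  by rewrite ler_pM2l//; lra.
have : L * E <= L * d by rewrite ler_pM2l.
by lra.
Qed.

Lemma Hd_smooth f : smooth f ->
  (forall z, f (- (L / 2), z) = 0) -> (forall z, f (L / 2, z) = 0) ->
  (forall x, f (x, T) = 0) -> Hd f ('D_ex f) ('D_ez f).
Proof.
move=> sf fL fR fT; split.
- split; first exact: smooth_sqint.
  + exact: weak_derive_smooth.
  + exact: weak_derive_smooth.
- by apply: approx_smooth => // s _; exact: fL.
- by apply: approx_smooth => // s _; exact: fR.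
- by apply: approx_smooth => // s _; exact: fT.
Qed.

End sobolev_zero_sides.

(** * The functional as a quadratic form *)

Section energy.
Context {R : realType} (L T rho g Lambda eps v : R).
Variable mu : {finite_measure set (measurableTypeR R) -> \bar R}.
Hypotheses (L0 : 0 < L) (T0 : 0 < T) (rho0 : 0 < rho) (g0 : 0 < g)
  (v0 : 0 < v) (eps0 : 0 < eps).
Local Notation Om := (Omega L T).
Local Notation R2 := (measurableTypeR R * measurableTypeR R)%type.
Local Notation sq := (sqint leb2 Om).
Local Notation nsq := (ssq leb2 Om).
Local Notation S := (`[1, Lambda]%classic : set (measurableTypeR R)).
Implicit Types (u w : R * R -> R) (p : R * R) (l : R).

Let mOm : measurable (Om : set R2). Proof. exact: measurable_Omega. Qed.
Let mS : measurable S. Proof. exact: measurable_itv. Qed.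

(** Together with [ksin], the real and imaginary parts of the kernel of [Tf]; [|T_f|^2] becomes a
    sum of two squares of real inner products. *)
Definition kcos l p : R := expR (- (l ^+ 2 * v * p.2)) * cos (- (l * v * p.1)).
Definition ksin l p : R := expR (- (l ^+ 2 * v * p.2)) * sin (- (l * v * p.1)).

Let cexp l : continuous (fun p : R * R => expR (- (l ^+ 2 * v * p.2))).
Proof.
move=> p; apply: (@continuous_comp _ _ _ (fun p : R * R => - (l ^+ 2 * v * p.2)) expR).
  by apply: cvgN; apply: cvgM; [exact: cvg_cst|exact: cvg_snd].
exact: continuous_expR.
Qed.

Let carg l : continuous (fun p : R * R => - (l * v * p.1)).
Proof.
by move=> p; apply: cvgN; apply: cvgM; [exact: cvg_cst|exact: cvg_fst].
Qed.

Lemma continuous_kcos l : continuous (kcos l).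
Proof.
move=> p; apply: cvgM; first exact: cexp.
apply: (@continuous_comp _ _ _ (fun p : R * R => - (l * v * p.1)) cos); first exact: carg.
exact: continuous_cos.
Qed.

Lemma continuous_ksin l : continuous (ksin l).
Proof.
move=> p; apply: cvgM; first exact: cexp.
apply: (@continuous_comp _ _ _ (fun p : R * R => - (l * v * p.1)) sin); first exact: carg.
exact: continuous_sin.
Qed.

Let expR_le1_Omega l p : Om p -> `|expR (- (l ^+ 2 * v * p.2))| <= 1.
Proof.
move=> /OmegaP[_ /andP[z0 _]]; rewrite ger0_norm ?expR_ge0//.
rewrite -expR0 ler_expR oppr_le0 mulr_ge0 ?(ltW z0)// mulr_ge0 ?(ltW v0)//.
exact: sqr_ge0.
Qed.

Lemma kcos_le1 l p : Om p -> `|kcos l p| <= 1.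
Proof.
move=> Op; rewrite normrM mulr_ile1 ?expR_le1_Omega//.
by rewrite ler_norml cos_geN1 cos_le1.
Qed.

Lemma ksin_le1 l p : Om p -> `|ksin l p| <= 1.
Proof.
move=> Op; rewrite normrM mulr_ile1 ?expR_le1_Omega//.
by rewrite ler_norml sin_geN1 sin_le1.
Qed.

Section kernel.
Variable k : R -> R * R -> R.
Hypotheses (ck : forall l, continuous (k l)) (k1 : forall l p, Om p -> `|k l p| <= 1)
  (ckl : forall p, continuous (k ^~ p)).

Lemma kernel_sq l : sq (k l).
Proof. exact: continuous_sqint. Qed.

(** Cauchy-Schwarz: a kernel bounded by [1] has squared norm at most the area [L T], whatever
    [l]. *)
Lemma kernel_bound u l : sq u -> ip leb2 Om u (k l) ^+ 2 <= (L * T) * nsq u.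
Proof.
move=> su; apply: le_trans (cauchy_schwarz mOm su (kernel_sq l)) _.
rewrite mulrC ler_wpM2r ?ssq_ge0//.
have := ssq_bounded mOm (leb2_Omega_lty L T) (proj1 (kernel_sq l)) (k1 l).
by rewrite leb2_Omega// expr1n mul1r.
Qed.

Lemma kernel_measurable u : sq u ->
  measurable_fun S (fun l => ip leb2 Om u (k l)).
Proof.
move=> su.
(* Continuity under the integral sign, dominated by [|u|]. It is established on an open interval,
   hence this neighbourhood of [[1, Lambda]]. *)
have c : {in (`]0, Lambda + 1[%classic : set R), continuous (fun l => ip leb2 Om u (k l))}.
  apply: (@continuity_under_integral R _ _ leb2 (fun l p => u p * k l p) Om mOm
    0 (Lambda + 1) _ _ (fun p => `|u p|)).
  - by move=> l _; exact: (sqint_mul mOm su (kernel_sq l)).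
  - apply: aeW => p _ l _; apply: cvgM; first exact: cvg_cst.
    exact: ckl.
  - exact: (integrable_norm (sqint_integrable su)).
  - move=> l _; apply: aeW => p Op; rewrite normrM ler_piMr//.
    exact: k1.
apply: (@measurable_funS _ _ _ _ (`]0, Lambda + 1[%classic : set (measurableTypeR R))).
- exact: measurable_itv.
- move=> l; rewrite /= !in_itv/= => /andP[? ?]; apply/andP; split; lra.
- have oI : open (`]0, Lambda + 1[%classic : set R) by exact: interval_open.
  exact: (open_continuous_measurable_fun oI c).
Qed.

Lemma kernel_sqint u : sq u -> sqint mu S (fun l => ip leb2 Om u (k l)).
Proof.
move=> su; apply: (@sqint_bounded _ _ _ _ _ mS _ (Num.sqrt ((L * T) * nsq u))).
- by rewrite -ge0_fin_numE//; exact: fin_num_measure.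
- exact: kernel_measurable.
- move=> l _; rewrite -sqrtr_sqr ler_wsqrtr//; exact: kernel_bound.
Qed.

Lemma kernel_ssq_le u : sq u ->
  ssq mu S (fun l => ip leb2 Om u (k l)) <= (L * T * fine (mu S)) * nsq u.
Proof.
move=> su; have := @ssq_bounded _ _ _ mu _ mS (fun l => ip leb2 Om u (k l))
  (Num.sqrt ((L * T) * nsq u)).
rewrite sqr_sqrtr; last by rewrite mulr_ge0 ?ssq_ge0// mulr_ge0// ltW.
rewrite [X in _ <= X]mulrAC; apply.
- by rewrite -ge0_fin_numE//; exact: fin_num_measure.
- exact: kernel_measurable.
- move=> l _; rewrite -sqrtr_sqr ler_wsqrtr//; exact: kernel_bound.
Qed.

Lemma kernel_lin u w a b : sq u -> sq w ->
  (fun l => ip leb2 Om (fun p => a * u p + b * w p) (k l)) =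
  (fun l => a * ip leb2 Om u (k l) + b * ip leb2 Om w (k l)).
Proof.
by move=> su sw; apply/funext => l; rewrite (ip_linl mOm a b su sw (kernel_sq l)).
Qed.

End kernel.

Let continuous_sqr_arg (c d : R) : continuous (fun l : R => - (l ^+ 2 * c * d)).
Proof.
move=> l; apply: cvgN; apply: cvgM; last exact: cvg_cst.
apply: cvgM; last exact: cvg_cst.
by apply: (cvgM cvg_id cvg_id).
Qed.

Let continuous_lin_arg (c d : R) : continuous (fun l : R => - (l * c * d)).
Proof.
move=> l; apply: cvgN; apply: cvgM; last exact: cvg_cst.
apply: cvgM; [exact: cvg_id|exact: cvg_cst].
Qed.

Let ckl_cos p : continuous (kcos ^~ p).
Proof.
move=> l; apply: cvgM.
  apply: (@continuous_comp _ _ _ (fun l => - (l ^+ 2 * v * p.2)) expR).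
    exact: continuous_sqr_arg.
  exact: continuous_expR.
apply: (@continuous_comp _ _ _ (fun l => - (l * v * p.1)) cos).
  exact: continuous_lin_arg.
exact: continuous_cos.
Qed.

Let ckl_sin p : continuous (ksin ^~ p).
Proof.
move=> l; apply: cvgM.
  apply: (@continuous_comp _ _ _ (fun l => - (l ^+ 2 * v * p.2)) expR).
    exact: continuous_sqr_arg.
  exact: continuous_expR.
apply: (@continuous_comp _ _ _ (fun l => - (l * v * p.1)) sin).
  exact: continuous_lin_arg.
exact: continuous_sin.
Qed.

(* [Tcos] and [Tsin] are the real and imaginary parts of [T_f(v, l)] when
   [u] is the derivative of [f] in [x], and [energy u w] is then [N f] for [f]
   of gradient [(u, w)]. *)
Definition Tcos u l := ip leb2 Om u (kcos l).
Definition Tsin u l := ip leb2 Om u (ksin l).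

Definition energy u w : R :=
  4 * rho * g * v / pi * (ssq mu S (Tcos u) + ssq mu S (Tsin u)) +
  eps * (nsq u + nsq w).

Let c0_ge0 : 0 <= 4 * rho * g * v / pi.
Proof. by rewrite divr_ge0 ?pi_ge0// !mulr_ge0// ltW. Qed.

Let sTc u : sq u -> sqint mu S (Tcos u).
Proof. exact: (kernel_sqint continuous_kcos kcos_le1 ckl_cos). Qed.
Let sTs u : sq u -> sqint mu S (Tsin u).
Proof. exact: (kernel_sqint continuous_ksin ksin_le1 ckl_sin). Qed.

(** [B] is the polar form; only its independence of [a] and [b] matters. The identity serves at
    [(1/2, 1/2)] and [(1, -1)] for the parallelogram argument, and at [(s, 1)] and [(1, -1)] for the
    limit. *)
Lemma energy_lin u w u' w' : sq u -> sq w -> sq u' -> sq w' ->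
  exists B : R, forall a b, energy (fun p => a * u p + b * u' p)
    (fun p => a * w p + b * w' p) =
    a ^+ 2 * energy u w + 2 * a * b * B + b ^+ 2 * energy u' w'.
Proof.
move=> su sw su' sw'.
exists (4 * rho * g * v / pi * (ip mu S (Tcos u) (Tcos u') + ip mu S (Tsin u) (Tsin u'))
  + eps * (ip leb2 Om u u' + ip leb2 Om w w')) => a b.
rewrite /energy.
have -> : Tcos (fun p => a * u p + b * u' p) = (fun l => a * Tcos u l + b * Tcos u' l).
  exact: (kernel_lin continuous_kcos).
have -> : Tsin (fun p => a * u p + b * u' p) = (fun l => a * Tsin u l + b * Tsin u' l).
  exact: (kernel_lin continuous_ksin).
rewrite (ssq_lin mS a b (sTc su) (sTc su')) (ssq_lin mS a b (sTs su) (sTs su')).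
rewrite (ssq_lin mOm a b su su') (ssq_lin mOm a b sw sw').
set c0 := _ / pi; move: c0 (ssq mu S _) (ssq mu S _) (ssq mu S _) (ssq mu S _)
  (ip mu S _ _) (ip mu S _ _) (nsq _) (nsq _) (nsq _) (nsq _) (ip leb2 Om _ _)
  (ip leb2 Om _ _) => *; ring.
Qed.

Lemma energy_ge u w : eps * (nsq u + nsq w) <= energy u w.
Proof. by rewrite lerDr mulr_ge0// addr_ge0// ssq_ge0. Qed.

Lemma energy_le : exists2 K : R, 0 < K & forall u w, sq u -> sq w ->
  energy u w <= K * (nsq u + nsq w).
Proof.
pose C := L * T * fine (mu S).
have C0 : 0 <= C by rewrite mulr_ge0 ?fine_ge0// mulr_ge0// ltW.
exists (4 * rho * g * v / pi * (2 * C) + eps).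
  by rewrite ltr_wpDl// mulr_ge0// mulr_ge0.
move=> u w su sw; rewrite /energy [leRHS]mulrDl lerD2r.
rewrite -[leRHS]mulrA ler_wpM2l//.
have := kernel_ssq_le continuous_kcos kcos_le1 ckl_cos su.
have := kernel_ssq_le continuous_ksin ksin_le1 ckl_sin su.
rewrite -/(Tcos u) -/(Tsin u) -/C => h1 h2.
have := ssq_ge0 leb2 Om w; have := ssq_ge0 leb2 Om u.
have := mulr_ge0 C0 (ssq_ge0 leb2 Om w); rewrite -/(Tcos u) -/(Tsin u).
move: (ssq mu S _) (ssq mu S _) (nsq _) (nsq _) h1 h2 => ? ? ? ? h1 h2; lra.
Qed.

Lemma energy_ae u w u' w' : sq u -> sq w -> sq u' -> sq w' ->
  {ae leb2, forall p, Om p -> u p = u' p} ->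
  {ae leb2, forall p, Om p -> w p = w' p} -> energy u w = energy u' w'.
Proof.
move=> su sw su' sw' Eu Ew; rewrite /energy.
have kk k : (forall l, continuous (k l)) ->
    (fun l => ip leb2 Om u (k l)) = (fun l => ip leb2 Om u' (k l)).
  move=> ck; apply/funext => l; apply: (ae_eq_Rintegral mOm).
  - apply: measurable_funM; first by have [] := su.
    exact: continuous_measurable2.
  - apply: measurable_funM; first by have [] := su'.
    exact: continuous_measurable2.
  - by apply: (ae2_imply Eu) => p /[apply] ->.
have -> : Tcos u = Tcos u' by exact: kk continuous_kcos.
have -> : Tsin u = Tsin u' by exact: kk continuous_ksin.
rewrite (ae_eq_ssq mOm (proj1 su) (proj1 su') Eu).
by rewrite (ae_eq_ssq mOm (proj1 sw) (proj1 sw') Ew).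
Qed.

(** For the reflected function [T] becomes minus its complex conjugate: the cosine part changes
    sign, the sine part is unchanged, and the modulus is the same. *)
Lemma energy_refl u w : sq u -> sq w ->
  energy (fun p => - u (refl p)) (w \o refl) = energy u w.
Proof.
move=> su sw; rewrite /energy (nsq_refl sw).
have -> : nsq (fun p => - u (refl p)) = nsq u.
  rewrite -[RHS](nsq_refl su); apply: eq_Rintegral => p _ /=; ring.
have prefl := @preimage_refl_Omega R L T.
have key k l : sq (k l) -> ip leb2 Om (fun p => u (refl p)) (k l \o refl) = ip leb2 Om u (k l).
  move=> sk; have := sqint_mul mOm su sk => If.
  exact: (Rintegral_preserving mOm (@measurable_refl R) (@leb2_refl R) prefl If).
have key2 k l (c : R) : sq (k l) -> (forall p, - k l p = c * k l (refl p)) ->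
    ip leb2 Om (fun p => - u (refl p)) (k l) = c * ip leb2 Om u (k l).
  move=> sk kc; rewrite -(key k l sk).
  have := sqint_mul mOm su sk => If.
  rewrite -(RintegralZl _ mOm (integrable_preserving mOm (@measurable_refl R) (@leb2_refl R) prefl If)).
  apply: eq_Rintegral => p _ /=; rewrite mulrCA -kc; ring.
have sk1 l : sq (kcos l) by apply: continuous_sqint; exact: continuous_kcos.
have sk2 l : sq (ksin l) by apply: continuous_sqint; exact: continuous_ksin.
have -> : Tcos (fun p => - u (refl p)) = (fun l => -1 * Tcos u l).
  apply/funext => l; apply: key2 => // p.
  by rewrite /kcos/= mulrN opprK cosN mulN1r.
have -> : Tsin (fun p => - u (refl p)) = (fun l => 1 * Tsin u l).
  apply/funext => l; apply: key2 => // p.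
  by rewrite /ksin/= mulrN opprK sinN mulrN opprK mul1r.
rewrite (ssqZ mS _ (sTc su)) (ssqZ mS _ (sTs su)).
by rewrite sqrrN expr1n [X in _ * (X + _)]mul1r [X in _ * (_ + X)]mul1r.
Qed.

(** Fubini's theorem turns the iterated integrals of [Tf] into inner products on the box. *)
Lemma Cintegral_cos_sin u l : sq u ->
  Cintegral `]- (L / 2), L / 2[ (fun x => Cintegral `]0, T[ (fun z =>
    ((u (x, z) * expR (- (l ^+ 2 * v * z)))%:C)%C * expi (- (l * v * x)))) =
  (Tcos u l +i* Tsin u l)%C.
Proof.
move=> su.
have sk1 : sq (kcos l) by apply: continuous_sqint; exact: continuous_kcos.
have sk2 : sq (ksin l) by apply: continuous_sqint; exact: continuous_ksin.
rewrite /Cintegral /Tcos /Tsin /ip.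
rewrite (Fubini_Omega_xz (sqint_mul mOm su sk1)).
rewrite (Fubini_Omega_xz (sqint_mul mOm su sk2)).
apply: (f_equal2 (fun a b : R => (a +i* b)%C)).
- apply: eq_Rintegral => x _.
  rewrite [LHS]/=.
  apply: eq_Rintegral => z _.
  by rewrite /kcos /= mul0r subr0 mulrA.
- apply: eq_Rintegral => x _.
  rewrite [LHS]/=.
  apply: eq_Rintegral => z _.
  by rewrite /ksin /= mul0r addr0 mulrA.
Qed.

Lemma Tf_cos_sin f l : sq (wD Om ex f) ->
  Tf L T f v l = (Tcos (wD Om ex f) l +i* Tsin (wD Om ex f) l)%C.
Proof. exact: Cintegral_cos_sin. Qed.

Lemma normc_sqr (a b : R) : Normc.normc (a +i* b)%C ^+ 2 = a ^+ 2 + b ^+ 2.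
Proof. by rewrite /= sqr_sqrtr// addr_ge0// sqr_ge0. Qed.

Lemma N_energy f : H L T f ->
  N L T rho g Lambda eps mu v f = energy (wD Om ex f) (wD Om ez f).
Proof.
move=> /Hd_of_H/Hd_sq[sf sx sz].
rewrite /N /energy; congr (_ + eps * _); last first.
  by rewrite /dirichlet RintegralD//; exact: sqint_sqr.
rewrite /wave_resistance; congr (_ * _).
rewrite /ssq -RintegralD//; last 2 first.
- exact: sqint_sqr (sTc sx).
- exact: sqint_sqr (sTs sx).
by apply: eq_Rintegral => l _; rewrite (Tf_cos_sin _ sx) normc_sqr.
Qed.

(** Frees [N] from the choice made in [wD]: any weak gradient gives the same energy. The quadratic
    identities apply to [N] through this lemma. *)
Lemma N_Hd f fx fz : Hd L T f fx fz ->
  N L T rho g Lambda eps mu v f = energy fx fz.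
Proof.
move=> Hf; have HH := H_of_Hd L0 T0 Hf; rewrite (N_energy HH).
have [Ex Ez] := Hd_wD L0 T0 Hf; have [_ sx sz] := Hd_sq Hf.
have [_ sx' sz'] := Hd_sq (Hd_of_H HH).
exact: energy_ae.
Qed.

End energy.

(** * Minimization *)

(** [P] and [Q] are the energies of two functions, [B] their polar form. The midpoint bound gives
    [-2 B <= P + Q - 4 m], so the energy of the difference is at most [2 (P + Q) - 4 m]. *)
Lemma parallelogram_gap {R : realFieldType} (P Q B X m a b : R) :
  P <= m + a -> Q <= m + b ->
  m <= 2^-1 ^+ 2 * P + 2 * 2^-1 * 2^-1 * B + 2^-1 ^+ 2 * Q ->
  X <= 1 ^+ 2 * P + 2 * 1 * (-1) * B + (-1) ^+ 2 * Q -> X <= 2 * (a + b).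
Proof. by rewrite !expr2 => h1 h2 h3 h4; lra. Qed.

(** The value [d = 0] is allowed, and gives uniqueness. *)
Lemma gap_split {R : realFieldType} (X Y eps d r1 r2 : R) : 0 < eps ->
  0 <= X -> 0 <= Y -> eps * (X + Y) <= 2 * (r1 + r2) ->
  r1 <= eps * d / 4 -> r2 <= eps * d / 4 -> X <= d /\ Y <= d.
Proof.
move=> e0 X0 Y0 h h1 h2.
have : eps * (X + Y) <= eps * d by lra.
by rewrite ler_pM2l// => ?; split; lra.
Qed.

(* The cross term of a nonnegative quadratic form is controlled by a small
   multiple [s P] and a large multiple [Q / s] of the diagonal terms. *)
Lemma quadratic_limit_le {R : realFieldType} (P Q B K X Z s d m e : R) :
  0 < s -> 0 < K -> s * (m + 1) = e / 3 -> d <= 1 -> d <= e / 3 ->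
  d * ((1 + s^-1) * K * 2) <= e / 3 ->
  X <= d -> Z <= d -> P <= m + d -> Q <= K * (X + Z) ->
  0 <= s ^+ 2 * P + 2 * s * 1 * B + 1 ^+ 2 * Q ->
  1 ^+ 2 * P + 2 * 1 * (-1) * B + (-1) ^+ 2 * Q <= m + e.
Proof.
move=> s0 K0 sm d1 d2 d3 Xd Zd Pm hQ hs.
have si : s * s^-1 = 1 by rewrite divff// gt_eqF.
have si0 : 0 < s^-1 by rewrite invr_gt0.
have hB : - (2 * B) <= s * P + s^-1 * Q.
  have : 0 <= s^-1 * (s ^+ 2 * P + 2 * s * 1 * B + 1 ^+ 2 * Q).
    by rewrite mulr_ge0// ltW.
  rewrite (_ : s^-1 * _ = (s * s^-1) * (s * P + 2 * B) + s^-1 * Q); last by ring.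
  by rewrite si; lra.
have hQ2 : Q <= K * (2 * d) by apply: le_trans hQ _; rewrite ler_pM2l//; lra.
have h1 : (1 + s^-1) * Q <= d * ((1 + s^-1) * K * 2).
  rewrite (_ : d * _ = (1 + s^-1) * (K * (2 * d))); last by ring.
  by rewrite ler_pM2l// addr_gt0.
have h2 : s * P <= s * (m + 1) by rewrite ler_pM2l//; lra.
by rewrite !expr2; lra.
Qed.

Section minimization.
Context {R : realType} (L T V rho g Lambda eps v : R).
Variable mu : {finite_measure set (measurableTypeR R) -> \bar R}.
Hypotheses (L0 : 0 < L) (T0 : 0 < T) (V0 : 0 < V) (rho0 : 0 < rho) (g0 : 0 < g)
  (v0 : 0 < v) (eps0 : 0 < eps).
Local Notation Om := (Omega L T).
Local Notation R2 := (measurableTypeR R * measurableTypeR R)%type.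
Local Notation sq := (sqint leb2 Om).
Local Notation nsq := (ssq leb2 Om).
Local Notation Cv := (CV L T V).
Local Notation Nf := (N L T rho g Lambda eps mu v).
Local Notation En := (energy L T rho g Lambda eps v mu).
Implicit Types (f u w : R * R -> R) (p : R * R).

Let mOm : measurable (Om : set R2). Proof. exact: measurable_Omega. Qed.

Let sq1 : sq (fun=> 1).
Proof. by apply: continuous_sqint => p; exact: cvg_cst. Qed.

Let NE := @N_Hd R L T rho g Lambda eps v mu L0 T0 v0.
Let Elin := @energy_lin R L T rho g Lambda eps v mu L0 T0 v0.
Let Ege := @energy_ge R L T rho g Lambda eps v mu rho0 g0 v0.

Lemma Rintegral_ip1 f : \int[leb2]_(p in Om) f p = ip leb2 Om f (fun=> 1).
Proof. by apply: eq_Rintegral => p _; rewrite mulr1. Qed.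

Lemma nsq1 : nsq (fun=> 1) = L * T.
Proof.
rewrite /ssq; under eq_Rintegral => p _ do rewrite expr1n.
by rewrite Rintegral_cst// leb2_Omega// mul1r.
Qed.

Lemma CV_midpoint f h : Cv f -> Cv h -> Cv (fun p => 2^-1 * f p + 2^-1 * h p).
Proof.
move=> [Hf If Pf] [Hh Ih Ph]; have Df := Hd_of_H Hf; have Dh := Hd_of_H Hh.
have [sf _ _] := Hd_sq Df; have [sh _ _] := Hd_sq Dh; split.
- exact: (H_of_Hd L0 T0 (Hd_lin 2^-1 2^-1 Df Dh)).
- move: If Ih; rewrite !Rintegral_ip1 => If Ih.
  by rewrite (ip_linl mOm _ _ sf sh sq1) If Ih; field.
- apply: (ae2_imply2 Pf Ph) => p Pp Ph' Op.
  by rewrite addr_ge0// mulr_ge0// ?invr_ge0// ?Pp ?Ph'.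
Qed.

Lemma CV_refl f : Cv f -> Cv (f \o refl) /\ Nf (f \o refl) = Nf f.
Proof.
move=> [Hf If Pf]; have Df := Hd_of_H Hf; have Dr := Hd_refl Df.
have [sf sx sz] := Hd_sq Df.
have prefl := @preimage_refl_Omega R L T.
split; last first.
  by rewrite (NE Dr) (NE Df) energy_refl.
split.
- exact: (H_of_Hd L0 T0 Dr).
- rewrite -If; apply: (Rintegral_preserving mOm (@measurable_refl R) (@leb2_refl R) prefl).
  exact: sqint_integrable.
- have := ae_preserving (@measurable_refl R) (@leb2_refl R) Pf.
  move=> H; apply: (ae2_imply H) => p Hp Op; apply: Hp.
  by have : (refl @^-1` Om) p by rewrite prefl.
Qed.

(** A multiple of [(L^2/4 - x^2) (T - z)], which is positive inside and vanishes on the two lateral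
    sides and on the top. *)
Lemma CV_nonempty : exists f, Cv f.
Proof.
pose b (x : R) := L ^+ 2 / 4 * 1 + (-1) * (x * x).
pose c (z : R) := T * 1 + (-1) * z.
pose f0 p := b p.1 * c p.2.
have sf0 : smooth f0.
  move=> k; apply: CkM.
    apply: (@Ck_fst _ k b); apply: C1k_lin; first exact: C1k_cst.
    by apply: C1kM; exact: C1k_id.
  apply: (@Ck_snd _ k c); apply: C1k_lin; first exact: C1k_cst.
  exact: C1k_id.
have f0L z : f0 (- (L / 2), z) = 0 by rewrite /f0 /b /=; field.
have f0R z : f0 (L / 2, z) = 0 by rewrite /f0 /b /=; field.
have f0T x : f0 (x, T) = 0 by rewrite /f0 /c /=; ring.
have D0 := Hd_smooth L0 T0 sf0 f0L f0R f0T.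
have pos p : Om p -> 0 < f0 p.
  move=> /OmegaP[/andP[? ?] /andP[? ?]]; rewrite /f0 /b /c mulr_gt0//; last by lra.
  by nra.
have s0 := smooth_sqint L T sf0.
pose I0 := \int[leb2]_(p in Om) f0 p.
have I0_gt0 : 0 < I0.
  rewrite lt_neqAle Rintegral_ge0 ?andbT; last by move=> p /pos/ltW.
  apply/eqP => I00.
  have : {ae leb2, forall p, Om p -> f0 p = 0}.
    have : (\int[leb2]_(p in Om) `|(f0 p)%:E|)%E = 0%E.
      rewrite -[RHS]/((0 : R)%:E) I00 /I0 fineK.
        by apply: eq_integral => p /set_mem /pos/ltW fp; rewrite gee0_abs.
      by apply: integrable_fin_num => //; exact: sqint_integrable.
    move/ae_eq_integral_abs => /(_ mOm (measurable_int _ (sqint_integrable s0))).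
    by move=> H; apply: (ae2_imply H) => p /[apply] -[].
  (* As [f0] is positive on the whole box, the exceptional null set would contain the box, of area
     [L T > 0]. *)
  move=> [Z [mZ Z0 HZ]].
  have : (leb2 Om <= leb2 Z)%E.
    apply: le_measure; rewrite ?inE//.
    by move=> p Op; apply: HZ => /= H; have := pos _ Op; rewrite H// ltxx.
  by rewrite Z0 leb2_Omega// lee_fin leNgt mulr_gt0.
exists (fun p => (V / I0) * f0 p + 0 * f0 p); split.
- exact: (H_of_Hd L0 T0 (Hd_lin (V / I0) 0 D0 D0)).
- rewrite Rintegral_ip1 (ip_linl mOm _ _ s0 s0 sq1) -Rintegral_ip1 -/I0.
  by rewrite mul0r addr0 divfK// gt_eqF.
- apply: aeW => p /pos/ltW fp.
  by rewrite mul0r addr0 mulr_ge0// divr_ge0// ltW.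
Qed.

Let ssq_lin1B u w : nsq (fun p => 1 * u p + (-1) * w p) = nsq (fun p => u p - w p).
Proof. by apply: eq_ssq => p _; rewrite mul1r mulN1r. Qed.

Let energy_ge0 u w : 0 <= En u w.
Proof. by apply: le_trans (Ege _ _); rewrite mulr_ge0 ?(ltW eps0)// addr_ge0// ssq_ge0. Qed.

Lemma energy_sub_le u w u' w' (m a b : R) : sq u -> sq w -> sq u' -> sq w' ->
  m <= En (fun p => 2^-1 * u p + 2^-1 * u' p) (fun p => 2^-1 * w p + 2^-1 * w' p) ->
  En u w <= m + a -> En u' w' <= m + b ->
  eps * (nsq (fun p => u p - u' p) + nsq (fun p => w p - w' p)) <= 2 * (a + b).
Proof.
move=> su sw su' sw'; have [B HB] := Elin su sw su' sw'.
rewrite HB => h3 h1 h2; apply: (parallelogram_gap h1 h2 h3).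
by rewrite -HB -!ssq_lin1B.
Qed.

(** The limit is written as the approximant minus the error, and the quadratic form is expanded at
    [(1, -1)]. *)
Lemma energy_lim (m : R) u w : 0 <= m -> sq u -> sq w ->
  (forall d : R, 0 < d -> exists u' w', [/\ sq u' /\ sq w', En u' w' <= m + d,
     nsq (fun p => u' p - u p) <= d & nsq (fun p => w' p - w p) <= d]) ->
  En u w <= m.
Proof.
move=> m_ge0 su sw lim; apply/ler_addgt0Pr => e e0.
have [K K0 HK] := @energy_le R L T rho g Lambda eps v mu L0 T0 rho0 g0 v0 eps0.
(* The excess splits into thirds of [e]: the cross term costs [s] times an energy at most [m + 1],
   the approximant is within [d] of [m], and the error energy weighs at most [d * C]. *)
pose s := e / (3 * (m + 1)).
have s0 : 0 < s by rewrite divr_gt0// mulr_gt0// ltr_wpDl.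
have sm : s * (m + 1) = e / 3 by rewrite /s; field; rewrite gt_eqF// ltr_wpDl.
pose C := (1 + s^-1) * K * 2.
have C0 : 0 < C by rewrite !mulr_gt0// addr_gt0// invr_gt0.
pose d := Num.min 1 (Num.min (e / 3) (e / 3 / C)).
have d0 : 0 < d by rewrite !lt_min ltr01 !divr_gt0.
have d1 : d <= 1 by rewrite ge_min lexx.
have d2 : d <= e / 3 by rewrite !ge_min lexx !orbT.
have d3 : d * C <= e / 3 by rewrite -ler_pdivlMr// !ge_min lexx !orbT.
have [u' [w' [[su' sw'] h1 h2 h3]]] := lim _ d0.
have sdu := sqintB mOm su' su; have sdw := sqintB mOm sw' sw.
have [B HB] := Elin su' sw' sdu sdw.
have -> : En u w = En (fun p => 1 * u' p + (-1) * (u' p - u p))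
    (fun p => 1 * w' p + (-1) * (w' p - w p)).
  by apply: f_equal2; apply/funext => p; rewrite mul1r mulN1r opprB addrC subrK.
rewrite HB; apply: (quadratic_limit_le s0 K0 sm d1 d2 d3 h2 h3 h1 (HK _ _ sdu sdw)).
by rewrite -HB.
Qed.

(* The midpoint of two admissible functions is admissible, so by the
   parallelogram identity the distance between the two functions is controlled
   by how much they fail to be minimizers. *)
Lemma energy_gap f h (m a b : R) : Cv f -> Cv h -> (forall k, Cv k -> m <= Nf k) ->
  Nf f <= m + a -> Nf h <= m + b ->
  eps * (nsq (fun p => wD Om ex f p - wD Om ex h p) +
         nsq (fun p => wD Om ez f p - wD Om ez h p)) <= 2 * (a + b).
Proof.
move=> Cf Ch mN; have [Hf _ _] := Cf; have [Hh _ _] := Ch.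
have Df := Hd_of_H Hf; have Dh := Hd_of_H Hh.
have [_ sx sz] := Hd_sq Df; have [_ sx' sz'] := Hd_sq Dh.
have := mN _ (CV_midpoint Cf Ch).
rewrite (NE (Hd_lin 2^-1 2^-1 Df Dh)) (NE Df) (NE Dh).
exact: (energy_sub_le sx sz sx' sz').
Qed.

Lemma CV_diff f h : Cv f -> Cv h ->
  nsq (fun p => f p - h p) <=
  16 * L ^+ 2 * nsq (fun p => wD Om ex f p - wD Om ex h p).
Proof.
move=> [Hf _ _] [Hh _ _].
have := poincare L0 (Hd_lin 1 (-1) (Hd_of_H Hf) (Hd_of_H Hh)).
have E u w : nsq (fun p => 1 * u p + (-1) * w p) = nsq (fun p => u p - w p).
  by apply: eq_ssq => p _; rewrite mul1r mulN1r.
by rewrite !E.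
Qed.

Lemma CV_lim f fx fz : Hd L T f fx fz ->
  (forall d : R, 0 < d -> exists2 h, Cv h & nsq (fun p => h p - f p) <= d) ->
  Cv f.
Proof.
move=> Df HL; have [sf _ _] := Hd_sq Df; split.
- exact: (H_of_Hd L0 T0 Df).
- apply/eqP; rewrite -subr_eq0 -sqrf_eq0 eq_le sqr_ge0 andbT.
  apply/ler_addgt0Pl => e e0; rewrite addr0.
  have LT0 : 0 < L * T by rewrite mulr_gt0.
  (* The mean is the inner product with [1], whose squared norm is [L T], hence the accuracy
     [e / (L * T)]. *)
  have [h [Hh Ih _] hf] := HL _ (divr_gt0 e0 LT0).
  have [sh _ _] := Hd_sq (Hd_of_H Hh).
  have := cauchy_schwarz mOm (sqintB mOm sh sf) sq1; rewrite nsq1.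
  have -> : ip leb2 Om (fun p => h p - f p) (fun=> 1) = V - \int[leb2]_(p in Om) f p.
    rewrite -Ih !Rintegral_ip1.
    have := ip_linl mOm 1 (-1) sh sf sq1; rewrite mul1r mulN1r => <-.
    by apply: eq_Rintegral => p _; rewrite mul1r mulN1r.
  rewrite -sqrrN opprB => /le_trans; apply.
  by rewrite -ler_pdivlMr.
(* The negative part of the limit is shown to have norm zero: it is bounded by the distance from [f]
   to any nonnegative function. *)
- pose m p := Num.max (- f p) 0.
  have mm : measurable_fun (Om : set R2) m.
    apply: measurable_maxr; last exact: measurable_cst.
    by apply: measurableT_comp => //; have [] := sf.
  have sm : sq m.
    split => //; apply: (le_integrableR mOm (g := fun p => f p ^+ 2)).
    + exact: measurable_funX.
    + move=> p _; rewrite ger0_norm ?sqr_ge0// /m.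
      by have [h|h] := leP (- f p) 0; rewrite ?expr0n ?sqr_ge0// sqrrN.
    + exact: sqint_sqr.
  have m0 : nsq m = 0.
    apply/eqP; rewrite eq_le ssq_ge0 andbT; apply/ler_addgt0Pl => e e0.
    rewrite addr0; have [h [Hh Ih Ph] hf] := HL _ e0; apply: le_trans hf.
    have [sh _ _] := Hd_sq (Hd_of_H Hh).
    (* Truncation makes [h] nonnegative at every point, as the pointwise comparison in [ssq_le]
       requires, and changes it only on a null set. *)
    pose h' p := Num.max (h p) 0.
    have mh' : measurable_fun (Om : set R2) h'.
      by apply: measurable_maxr; [have [] := sh|exact: measurable_cst].
    have sh' : sq h'.
      split => //; apply: (le_integrableR mOm (g := fun p => h p ^+ 2)).
      + exact: measurable_funX.
      + move=> p _; rewrite ger0_norm ?sqr_ge0// /h'.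
        by have [h0|h0] := leP (h p) 0; rewrite ?expr0n ?sqr_ge0.
      + exact: sqint_sqr.
    have -> : nsq (fun p => h p - f p) = nsq (fun p => h' p - f p).
      apply: (ae_eq_ssq mOm).
      + by have [] := sqintB mOm sh sf.
      + by have [] := sqintB mOm sh' sf.
      + by apply: (ae2_imply Ph) => p /[apply] hp; rewrite /h' max_l.
    rewrite -[leRHS]mul1r -[X in X * _](expr1n _ 2).
    apply: (ssq_le mOm ler01 sm (sqintB mOm sh' sf)) => p _.
    rewrite mul1r /m /h' ger0_norm ?le_max ?lexx ?orbT//.
    rewrite ge_max normr_ge0 andbT; apply: le_trans (ler_norm _).
    by rewrite lerDr le_max lexx orbT.
  apply: (ae2_imply (ssq_eq0 mOm sm m0)) => p /[apply]; rewrite /m => H.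
  by rewrite -oppr_le0 -H le_max lexx.
Qed.

Lemma minimizer_exists : exists f, minimizer Cv Nf f.
Proof.
pose A := [set x | exists2 f, Cv f & x = Nf f].
have NfE f : Cv f -> Nf f = En (wD Om ex f) (wD Om ez f).
  by move=> [Hf _ _]; exact: (NE (Hd_of_H Hf)).
have Nf_ge0 f : Cv f -> 0 <= Nf f.
  move=> Cf; rewrite (NfE _ Cf); apply: le_trans (Ege _ _).
  by rewrite mulr_ge0 ?(ltW eps0)// addr_ge0// ssq_ge0.
have hA : has_inf A.
  split; first by have [f Cf] := CV_nonempty; exists (Nf f), f.
  by exists 0 => _ [f Cf ->]; exact: Nf_ge0.
pose m := inf A.
have mN f : Cv f -> m <= Nf f.
  by move=> Cf; apply: ge_inf; [exact: hA.2|exists f].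
have m_ge0 : 0 <= m.
  by apply: lb_le_inf; [exact: hA.1|move=> _ [f Cf ->]; exact: Nf_ge0].
have /choice[f Hf] : forall n : nat, exists f, Cv f /\ Nf f <= m + n.+1%:R^-1.
  move=> n; have n0 : 0 < n.+1%:R^-1 :> R by rewrite invr_gt0.
  have [_ [f Cf ->] fm] := inf_adherent n0 hA.
  by exists f; split => //; exact: ltW.
have Cf n : Cv (f n) by have [] := Hf n.
have Df n : Hd L T (f n) (wD Om ex (f n)) (wD Om ez (f n)).
  by apply: Hd_of_H; have [] := Cf n.
have sf n : sq (f n) by have [] := Hd_sq (Df n).
have sx n : sq (wD Om ex (f n)) by have [] := Hd_sq (Df n).
have sz n : sq (wD Om ez (f n)) by have [] := Hd_sq (Df n).
have small (d : R) : 0 < d -> exists N, forall n, (N <= n)%N -> n.+1%:R^-1 <= d.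
  move=> d0; have [N _ HN] := near_infty_natSinv_lt (PosNum d0).
  by exists N => n /HN /ltW.
have gap n k := energy_gap (Cf n) (Cf k) mN (Hf n).2 (Hf k).2.
have cauchy (d : R) : 0 < d -> exists N, forall n k, (N <= n)%N -> (N <= k)%N ->
    nsq (fun p => wD Om ex (f n) p - wD Om ex (f k) p) <= d /\
    nsq (fun p => wD Om ez (f n) p - wD Om ez (f k) p) <= d.
  move=> d0; have d4 : 0 < eps * d / 4 by rewrite !mulr_gt0.
  have [N HN] := small _ d4; exists N => n k /HN Hn /HN Hk.
  have X0 := ssq_ge0 leb2 Om (fun p => wD Om ex (f n) p - wD Om ex (f k) p).
  have Z0 := ssq_ge0 leb2 Om (fun p => wD Om ez (f n) p - wD Om ez (f k) p).
  exact: (gap_split eps0 X0 Z0 (gap n k) Hn Hk).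
have L2 : 0 < 16 * L ^+ 2 by rewrite mulr_gt0// exprn_gt0.
have [|X [sX HX]] := ssq_complete mOm (leb2_Omega_lty L T) sx.
  move=> d /cauchy[N HN]; exists N => n k Nn Nk; exact: (proj1 (HN n k Nn Nk)).
have [|Z [sZ HZ]] := ssq_complete mOm (leb2_Omega_lty L T) sz.
  move=> d /cauchy[N HN]; exists N => n k Nn Nk; exact: (proj2 (HN n k Nn Nk)).
have [|F [sF HF]] := ssq_complete mOm (leb2_Omega_lty L T) sf.
  move=> d d0; have [N HN] := cauchy _ (divr_gt0 d0 L2).
  exists N => n k Nn Nk; have h := proj1 (HN n k Nn Nk).
  apply: le_trans (CV_diff (Cf n) (Cf k)) _.
  by rewrite mulrC -ler_pdivlMr.
have lim (d : R) : 0 < d -> exists n, [/\ n.+1%:R^-1 <= d,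
    nsq (fun p => f n p - F p) <= d,
    nsq (fun p => wD Om ex (f n) p - X p) <= d &
    nsq (fun p => wD Om ez (f n) p - Z p) <= d].
  move=> d0; have [N1 H1] := HF _ d0; have [N2 H2] := HX _ d0.
  have [N3 H3] := HZ _ d0; have [N4 H4] := small _ d0.
  exists (maxn (maxn N1 N2) (maxn N3 N4)); split.
  - by apply: H4; rewrite !leq_max leqnn !orbT.
  - by apply: H1; rewrite !leq_max leqnn.
  - by apply: H2; rewrite !leq_max leqnn !orbT.
  - by apply: H3; rewrite !leq_max leqnn !orbT.
have DF : Hd L T F X Z.
  apply: (Hd_lim sF sX sZ) => d /lim[n [_ h1 h2 h3]].
  exists (f n), (wD Om ex (f n)), (wD Om ez (f n)); exact: (And4 (Df n) h1 h2 h3).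
have CF : Cv F.
  by apply: (CV_lim DF) => d /lim[n [_ h1 _ _]]; exists (f n).
have NFm : Nf F <= m.
  rewrite (NE DF); apply: (energy_lim m_ge0 sX sZ) => d /lim[n [h0 _ h2 h3]].
  have Pm := (Hf n).2; rewrite (NfE _ (Cf n)) in Pm.
  exists (wD Om ex (f n)), (wD Om ez (f n)).
  exact: (And4 (conj (sx n) (sz n)) (le_trans Pm (lerD (lexx m) h0)) h2 h3).
by exists F; exact: (conj CF (fun h Ch => le_trans NFm (mN h Ch))).
Qed.

Lemma minimizer_unique f h : minimizer Cv Nf f -> minimizer Cv Nf h ->
  {ae leb2, forall p, Om p -> h p = f p}.
Proof.
move=> [Cf mf] [Ch mh].
have hf : Nf h <= Nf f + 0 by rewrite addr0; exact: mh.
have ff : Nf f <= Nf f + 0 by rewrite addr0.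
have X0 := ssq_ge0 leb2 Om (fun p => wD Om ex h p - wD Om ex f p).
have Z0 := ssq_ge0 leb2 Om (fun p => wD Om ez h p - wD Om ez f p).
(* Both functions attain the minimum, so the gap is zero and [gap_split] applies with [d = 0]. *)
have r0 : (0 : R) <= eps * 0 / 4 by rewrite mulr0 mul0r.
have [X_le0 _] := gap_split eps0 X0 Z0 (energy_gap Ch Cf mf hf ff) r0 r0.
have [Hf _ _] := Cf; have [Hh _ _] := Ch.
have [sf _ _] := Hd_sq (Hd_of_H Hf); have [sh _ _] := Hd_sq (Hd_of_H Hh).
have sd := sqintB mOm sh sf.
have n0 : nsq (fun p => h p - f p) = 0.
  apply/eqP; rewrite eq_le ssq_ge0 andbT; apply: le_trans (CV_diff Ch Cf) _.
  by rewrite mulr_ge0_le0// mulr_ge0// sqr_ge0.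
by apply: (ae2_imply (ssq_eq0 mOm sd n0)) => p /[apply]/subr0_eq.
Qed.

End minimization.

Theorem theorem3p1 (R : realType) (L T rho g V v eps Lambda : R)
    (L_gt0 : 0 < L) (T_gt0 : 0 < T) (rho_gt0 : 0 < rho) (g_gt0 : 0 < g)
    (V_gt0 : 0 < V) (v_gt0 : 0 < v) (eps_gt0 : 0 < eps) (Lambda_gt1 : 1 < Lambda)
    (mu : {finite_measure set (measurableTypeR R) -> \bar R}) :
  exists f : R * R -> R,
    [/\ minimizer (CV L T V) (N L T rho g Lambda eps mu v) f,
        forall h : R * R -> R,
          minimizer (CV L T V) (N L T rho g Lambda eps mu v) h ->
          {ae leb2, forall p, Omega L T p -> h p = f p}
      & {ae leb2, forall p, Omega L T p -> f (- p.1, p.2) = f p}].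
Proof.
have [f mf] := @minimizer_exists R L T V rho g Lambda eps v mu L_gt0 T_gt0 V_gt0 rho_gt0
  g_gt0 v_gt0 eps_gt0.
have uniq h := @minimizer_unique R L T V rho g Lambda eps v mu L_gt0 T_gt0
  rho_gt0 g_gt0 v_gt0 eps_gt0 f h mf.
exists f; split=> //; have [Cf Jf] := mf.
have [Cr Jr] := @CV_refl R L T V rho g Lambda eps v mu L_gt0 T_gt0 v_gt0 f Cf.
have Jr' h : CV L T V h ->
    N L T rho g Lambda eps mu v (f \o refl) <= N L T rho g Lambda eps mu v h.
  by rewrite Jr; exact: Jf.
exact: uniq (conj Cr Jr').
Qed.
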